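(* For every even integer $k\ge 4$, every integer $d$ with $k/2\le d\le k-1$ and every $\epsilon>0$ there exist $\gamma>0$ and $n_1$ such that for every $k$-graph $\mathcal{H}$ on $n\ge n_1$ vertices with $n\in \frac k2\mathbb N$ the following holds. If $\mathcal{H}$ is not $\epsilon$-close to any $\mathcal{B}_{n,k}$ or $\overline \mathcal{B}_{n,k}$ and $\delta_{d}(\mathcal{H}) \ge (\frac 12-\gamma) \binom{n-d}{k-d}$, then $\mathcal{H}$ contains a Hamilton $(k/2)$-cycle.
   Context: A $k$-graph has vertex set $V$ and edge set $E\subseteq\binom{V}{k}$; $\delta_d$ is the minimum number of edges containing a $d$-set, over all $d$-sets. A Hamilton $\ell$-cycle is a spanning subhypergraph whose vertices can be ordered cyclically so that each edge consists of $k$ consecutive vertices and consecutive edges share exactly $\ell$ vertices. For a partition $V=A\cup B$, a set is odd/even according to the parity of $|S\cap A|$; $\mathcal{B}_{n,k}(A,B)$ has as edges all odd $k$-subsets of $V$ and $\overline{\mathcal{B}}_{n,k}(A,B)$ all even $k$-subsets. We write $\mathcal{B}_{n,k}$ and $\overline{\mathcal{B}}_{n,k}$ for these hypergraphs with respect to some partition $V=A\cup B$ in which $|A|$ and $|B|$ differ by at most one (equal sizes). For $\epsilon>0$ and two $k$-graphs $\mathcal{H},\mathcal{H}'$ on $n$ vertices, $\mathcal{H}$ is $\epsilon$-close to $\mathcal{H}'$ if $\mathcal{H}$ can be made a copy of $\mathcal{H}'$ by adding and deleting at most $\epsilon n^k$ edges. *)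

(* Defs.v *)
From HB Require Import structures.
From mathcomp Require Import all_boot all_order all_algebra.
From mathcomp Require Import reals.
Set Implicit Arguments.
Unset Strict Implicit.
Unset Printing Implicit Defensive.
Import Order.TTheory GRing.Theory Num.Theory.

Record kgraph (k : nat) (V : finType) := KGraph {
  edges : {set {set V}};
  edges_card : forall e : {set V}, e \in edges -> #|e| = k }.

Section KGraphs.
Variables (k : nat) (V : finType).

Definition degree (H : kgraph k V) (S : {set V}) : nat :=
  #|[set e in edges H | S \subset e]|.

(* The seed #|edges H| bounds every degree, so this is the true minimum
   as soon as V has a subset of size d. *)
Definition min_degree (d : nat) (H : kgraph k V) : nat :=
  \big[minn/#|edges H|]_(S : {set V} | #|S| == d) degree H S.

(* The partition V = A u B is given by A alone, with B = ~: A. *)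
Definition balanced (A : {set V}) : Prop :=
  (#|A| <= #|~: A|.+1)%N /\ (#|~: A| <= #|A|.+1)%N.

Definition odd_edges (A : {set V}) : {set {set V}} :=
  [set e : {set V} | (#|e| == k) && odd #|e :&: A|].

Definition even_edges (A : {set V}) : {set {set V}} :=
  [set e : {set V} | (#|e| == k) && ~~ odd #|e :&: A|].

Lemma odd_edges_card (A e : {set V}) : e \in odd_edges A -> #|e| = k.
Proof. by rewrite inE => /andP[/eqP]. Qed.

Lemma even_edges_card (A e : {set V}) : e \in even_edges A -> #|e| = k.
Proof. by rewrite inE => /andP[/eqP]. Qed.

Definition odd_kgraph (A : {set V}) : kgraph k V :=
  KGraph (@odd_edges_card A).

Definition even_kgraph (A : {set V}) : kgraph k V :=
  KGraph (@even_edges_card A).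

Definition copy_of (G H : kgraph k V) : Prop :=
  exists2 f : V -> V, bijective f
    & edges G = [set f @: (e : {set V}) | e in edges H].

(* Edges added plus edges deleted number at most eps * n^k in total. *)
Definition eps_close (R : realType) (eps : R) (H H' : kgraph k V) : Prop :=
  exists2 G : kgraph k V, copy_of G H'
    & (#|(edges H :\: edges G) :|: (edges G :\: edges H)|%:R
         <= eps * #|V|%:R ^+ k :> R)%R.

(* The k consecutive vertices of the cyclic ordering s from position i on. *)
Definition window (s : seq V) (i : nat) : {set V} :=
  [set x in take k (rot i s)].

(* s is the cyclic ordering of the vertices, and p lists the positions at
   which the edges start, in increasing order; path.cycle compares each edge
   with the next one around the cycle, including the last with the first. *)
Definition hamilton_cycle (l : nat) (C : kgraph k V) : Prop :=
  exists (s : seq V) (p : seq nat),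
    [/\ uniq s /\ (forall x : V, x \in s),
        sorted ltn p /\ {in p, forall i, (i < #|V|)%N},
        forall e : {set V},
          e \in edges C <-> exists2 i : nat, i \in p & e = window s i,
        cycle (fun i j => #|window s i :&: window s j| == l) p
      & cover (edges C) = [set: V]].

Definition contains_hamilton_cycle (l : nat) (H : kgraph k V) : Prop :=
  exists2 C : kgraph k V, edges C \subset edges H & hamilton_cycle l C.

End KGraphs.

(* Main.v *)
Require Import Defs.
From mathcomp Require Import all_fingroup.
From mathcomp Require Import all_boot all_order all_algebra.
From mathcomp Require Import reals.
From mathcomp Require Import zify ring lra.
Import Order.TTheory GRing.Theory Num.Theory.
Set Implicit Arguments.
Unset Strict Implicit.
Unset Printing Implicit Defensive.

(* Write k = 2m and join two m-sets when their union is an edge; a Hamilton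
   (k/2)-cycle is a Hamilton cycle of this graph on the blocks of a partition of V
   into m-sets.  For a random partition, a bound on factorial moments shows that
   the blocks represent the densities of any polynomially large list of families of
   m-tuples, so the induced graph has minimum degree close to one half.  If every
   two near-halves of the m-tuples that are non-neighbourhoods span many edges,
   this graph is Hamiltonian.  Otherwise two of them span few edges, and they are
   almost complementary or almost equal.  In the first case, and in the second when
   the complement f = 0 of the sparse half f = 1 is sparse as well, adjacency of two
   m-tuples is almost f(S) + f(T) + c modulo 2; then f is almost a sum of vertex
   labels, and the hypergraph is close to an odd or even one.  There remains a sparse
   half whose complement spans many edges: exchanging one vertex between suitable
   pairs of blocks makes the sparse half smaller than t/2, and the degree
   sequence then forces a Hamilton cycle. *)

(** * Hamilton cycles in dense graphs *)

(** Since $d\ge k/2$, averaging turns the degree condition into one on $m$-sets, so every block has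
    degree about $t/2$, but possibly slightly less: $\gamma$ and the sampling error each cost a
    small multiple of $t$, so Dirac's theorem never applies directly. The last case shows the real
    obstacle: if more than $t/2$ blocks fall in a sparse half, they are nearly independent and the
    sampled partition may have no Hamilton cycle at all. The partition itself must then be altered,
    by $\tau t$ exchanges, a number exceeding all accumulated errors. Such exchanges exist because a
    set function that hardly any exchange changes is almost constant, whereas the half has density
    about $1/2$. Everything is phrased with tuples and averages: entries are then independent, and
    tuples with repetitions have density $O(1/n)$ and are never edges. The families to be sampled
    must be fixed before the partition is drawn; indexing them by all pairs of $m$-tuples covers
    whatever blocks arise later, including the exchanged ones. *)

Definition hamiltonian (T : finType) (e : rel T) : Prop :=
  exists s : seq T, [/\ uniq s, size s = #|T| & cycle e s].

Section Rotations.
Variables (T : finType) (e : rel T).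
Hypothesis e_sym : symmetric e.
Implicit Types (x y z : T) (s t u p : seq T).

Lemma path_rev_belast x p : path e (last x p) (rev (belast x p)) = path e x p.
Proof. by rewrite rev_path; apply: eq_path => y z; rewrite e_sym. Qed.

Lemma rev_belast_last x p : rev (x :: p) = last x p :: rev (belast x p).
Proof. by rewrite lastI rev_rcons. Qed.

Lemma last_rev_belast x p : last (last x p) (rev (belast x p)) = x.
Proof.
have := congr1 (last x) (rev_belast_last x p).
by rewrite rev_cons last_rcons.
Qed.

Lemma cycle_catE x s y t :
  cycle e ((x :: s) ++ (y :: t)) =
  [&& path e x s, e (last x s) y, path e y t & e (last y t) x].
Proof. by rewrite /= rcons_cat cat_path /= rcons_path. Qed.

(** The classical crossing: the two ends of the path see the two endpoints of one of its edges, and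
    that edge is dropped. *)
Lemma cycle_rotate2 x s y t : path e x (s ++ y :: t) ->
  e (last x s) (last y t) -> e x y -> cycle e ((x :: s) ++ rev (y :: t)).
Proof.
move=> pst e1 e2; have /and3P[ps _ pt]: [&& path e x s, e (last x s) y & path e y t].
  by move: pst; rewrite cat_path.
rewrite rev_belast_last cycle_catE ps e1 path_rev_belast pt /=.
by rewrite last_rev_belast e_sym.
Qed.

Lemma path_cat3 x s y t z u : path e x (s ++ y :: t ++ z :: u) ->
  [/\ path e x s, path e y t & path e z u].
Proof. by rewrite cat_path /= cat_path /= => /and5P[]. Qed.

(** Three chords reorder the segments $A$, $B$, $C$ of a path as $A\,C\,\overline{B}$ without losing
    a vertex; [cycle_shortcut] needs only two chords but loses $B$. *)
Lemma cycle_rotate3 x s y t z u : path e x (s ++ y :: t ++ z :: u) ->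
  e (last x s) z -> e (last y t) (last z u) -> e x y ->
  cycle e ((x :: s) ++ (z :: u) ++ rev (y :: t)).
Proof.
case/path_cat3=> ps pt pu e1 e2 e3.
rewrite rev_belast_last [_ ++ (_ :: _)]cat_cons cycle_catE ps e1 cat_path last_cat /=.
by rewrite pu path_rev_belast pt last_rev_belast e_sym e2 e_sym e3.
Qed.

Lemma cycle_shortcut x s y t z u : path e x (s ++ y :: t ++ z :: u) ->
  e (last x s) (last z u) -> e x z -> cycle e ((x :: s) ++ rev (z :: u)).
Proof.
case/path_cat3=> ps pt pu e1 e2.
rewrite rev_belast_last cycle_catE ps e1 path_rev_belast pu /=.
by rewrite last_rev_belast e_sym.
Qed.

End Rotations.

Section Closure.
Variable T : finType.
Implicit Types (e : rel T) (x y u v : T) (s p : seq T).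

Lemma complete_hamiltonian e : 1 < #|T| -> (forall x y, x != y -> e x y) ->
  hamiltonian e.
Proof.
move=> T2 eC; exists (enum T); rewrite enum_uniq -cardE; split=> //.
have pathC x p : uniq (x :: p) -> path e x p.
  elim: p x => //= y p IH x /and3P[xyp yp up].
  by rewrite IH ?yp ?up // eC //; apply: contra xyp => /eqP->; rewrite mem_head.
have := enum_uniq T; move: T2; rewrite cardE.
case: (enum T) => [|x [|y p]] // _ U.
rewrite /cycle rcons_path pathC //= eC //.
by apply: contraTneq U => <-; rewrite cons_uniq mem_last.
Qed.

Definition add_edge e u v : rel T :=
  fun x y => [|| e x y, (x == u) && (y == v) | (x == v) && (y == u)].

(** Once the cycle is rotated to start at [u], a new edge can occur only among the two edges at [u].
    These are distinct because [2 < #|T|], so at most one is new, and cutting there leaves a path in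
    [e]. *)
Lemma add_edge_hamiltonian_path e u v : symmetric e -> 2 < #|T| -> u != v ->
  hamiltonian (add_edge e u v) -> ~ hamiltonian e ->
  exists p, [/\ path e u p, last u p = v, uniq (u :: p) & size (u :: p) = #|T|].
Proof.
move=> e_sym T3 uv [s0 [Us0 Ss0 Cs0]] nh.
have us0 : u \in s0.
  apply: contraT => us0; have := max_card (mem (u :: s0)).
  by rewrite (card_uniqP _) /= ?us0 // Ss0 ltnn.
case/rot_to: us0 => i s rs.
have U : uniq (u :: s) by rewrite -rs rot_uniq.
have S : size (u :: s) = #|T| by rewrite -rs size_rot.
have C : cycle (add_edge e u v) (u :: s) by rewrite -rs rot_cycle.
case: s {rs} U S C => [|a s] U S C; first by rewrite -S in T3.
have Ps : path e a s.
  move: C; rewrite /= rcons_path => /and3P[_ P _].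
  move: U P; rewrite cons_uniq => /andP[]; move: (a) => b.
  elim: s b {S} => //= c s IH b; rewrite !inE !negb_or => /and3P[ub uc us].
  move=> /andP[b_cs Ucs] /andP[bc P]; apply/andP; split; last first.
    by apply: IH => //; rewrite inE negb_or uc us.
  case/or3P: bc => // /andP[/eqP E1 /eqP E2].
    by rewrite E1 eqxx in ub.
  by rewrite E2 eqxx in uc.
have ba : last a s != a.
  case: s U S {C Ps} => [|c s] U S; first by rewrite -S in T3.
  apply/eqP => /= E; move: U; rewrite /= => /and3P[_ + _].
  by rewrite -{1}E mem_last.
move: C; rewrite /= rcons_path => /and3P[ua _ bu].
have [eua|neua] := boolP (e u a); last first.
  exists (rev (a :: s)).
  have av : a = v.
    move: ua; rewrite /add_edge (negPf neua) eqxx /= (negPf uv) /=.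
    by rewrite orbF => /eqP.
  rewrite rev_belast_last /= last_rev_belast path_rev_belast // Ps.
  split=> //; last by rewrite size_rev size_belast.
    rewrite e_sym andbT.
    case/or3P: bu => // /andP[/eqP E1 /eqP E2]; first by rewrite E2 eqxx in uv.
    by rewrite E1 av eqxx in ba.
  have : uniq (u :: rev (a :: s)) by rewrite cons_uniq mem_rev rev_uniq.
  by rewrite rev_belast_last.
exists (a :: s); rewrite /= eua Ps; split=> //.
apply/eqP; apply: contraT => bv; case: nh; exists (u :: a :: s); split=> //.
rewrite /= eua rcons_path Ps /=; move: bu.
by case/or3P=> // /andP[/eqP E1 /eqP E2] //; rewrite ?E1 ?eqxx ?E2 ?eqxx in uv bv.
Qed.

(** Stands in for the choice of an edge-maximal counterexample: induction on the number of
    non-adjacent ordered pairs, where [Q] gathers the hypotheses that survive adding edges. *)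
Lemma maximal_nonhamiltonian (Q : rel T -> Prop) : 2 < #|T| ->
  (forall e e', subrel e e' -> Q e -> Q e') ->
  (forall e, symmetric e -> irreflexive e -> Q e -> ~ hamiltonian e ->
     (forall u v, u != v -> ~~ e u v -> exists p,
        [/\ path e u p, last u p = v, uniq (u :: p) & size (u :: p) = #|T|]) ->
     False) ->
  forall e, symmetric e -> irreflexive e -> Q e -> hamiltonian e.
Proof.
move=> T3 Qmono Qmax e.
have [n] := ubnP #|[set xy | ~~ e xy.1 xy.2]|.
elim: n e => // n IH e; rewrite ltnS => le_n e_sym e_irr Qe.
(* [hamiltonian] quantifies over all sequences; fixing the length by tuples makes it decidable. *)
have [//|nh] : hamiltonian e \/ ~ hamiltonian e.
  pose b := [exists s : #|T|.-tuple T, uniq s && cycle e s].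
  have [/existsP[s /andP[us cs]]|nb] := boolP b; [left|right].
    by exists s; rewrite size_tuple.
  case=> s [us /eqP ss cs]; case/existsP: nb; exists (Tuple ss).
  by rewrite us cs.
exfalso; apply: (Qmax e) => // u v uv neuv.
apply: add_edge_hamiltonian_path => //; apply: IH.
- apply: leq_trans le_n; apply: proper_card; apply/properP; split.
    by apply/subsetP=> xy; rewrite !inE; apply: contra => exy; rewrite /add_edge exy.
  by exists (u, v); rewrite !inE //= /add_edge !eqxx orbT.
- by move=> x y; rewrite /add_edge e_sym; do 4!case: eqP => _; case: (e y x).
- move=> x; rewrite /add_edge e_irr /=; apply/negP => /orP[]/andP[/eqP-> /eqP E];
    by move: uv; rewrite E eqxx.
- by apply: Qmono Qe => x y exy; rewrite /add_edge exy.
Qed.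

End Closure.

Section HamiltonianPath.
Variables (T : finType) (e : rel T) (u v : T) (p : seq T).
Hypotheses (e_sym : symmetric e) (e_irr : irreflexive e).
Hypotheses (path_p : path e u p) (last_p : last u p = v).
Hypotheses (uniq_p : uniq (u :: p)) (size_p : size (u :: p) = #|T|).
Local Notation vx i := (nth u (u :: p) i).

Lemma split_path i : i < size p -> exists s y t,
  [/\ p = s ++ y :: t, size s = i, last u s = vx i, y = vx i.+1 & last y t = v].
Proof.
move=> ip; exists (take i p), (nth u p i), (drop i.+1 p).
have E : p = take i p ++ nth u p i :: drop i.+1 p by rewrite -drop_nth // cat_take_drop.
split=> //; first by rewrite size_takel // ltnW.
  by rewrite (last_nth u) size_takel 1?ltnW // -[u :: take i p]/(take i.+1 (u :: p)) nth_take.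
by move: last_p; rewrite {1}E last_cat.
Qed.

Lemma split_path3 j i : j < i < size p -> exists s y t z w,
  [/\ p = s ++ y :: t ++ z :: w, size (y :: t) = i - j,
      last u s = vx j /\ y = vx j.+1, last y t = vx i /\ z = vx i.+1 & last z w = v].
Proof.
case/andP=> ji ip; have [q [z [w [Ep Sq Lq zE Lw]]]] := split_path ip.
exists (take j q), (nth u q j), (drop j.+1 q), z, w.
have jq : j < size q by rewrite Sq.
have E : q = take j q ++ nth u q j :: drop j.+1 q by rewrite -drop_nth // cat_take_drop.
have nthE l : l <= i -> nth u (u :: q) l = vx l.
  by move=> li; rewrite Ep -cat_cons nth_cat /= Sq ltnS li.
split=> //; first by rewrite Ep {1}E -catA.
- by rewrite /= size_drop Sq subnSK.
- rewrite -!nthE ?(ltnW ji) //; split=> //.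
  by rewrite (last_nth u) size_takel 1?ltnW // -[u :: take j q]/(take j.+1 (u :: q)) nth_take.
- by split=> //; move: Lq; rewrite {1}E last_cat.
Qed.

Lemma mem_path x : x \in u :: p.
Proof.
apply: contraT => xp; have := max_card (mem (x :: u :: p)).
by rewrite (card_uniqP _) /= ?xp // -size_p ltnn.
Qed.

(** Indices stand for edges of the path, the [i]-th joining positions [i] and [i.+1]. The shift is
    chosen so that a common element of [start_nbrs] and [end_nbrs] is exactly a crossing. *)
Definition start_nbrs := [set i : 'I_(size p) | e u (vx i.+1)].
Definition end_nbrs := [set i : 'I_(size p) | e (vx i) v].

Lemma card_start_nbrs : #|[set y | e u y]| <= #|start_nbrs|.
Proof.
suff /subset_leq_card le : [set y | e u y] \subset [set vx i.+1 | i : 'I_(size p) in start_nbrs].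
  exact: leq_trans le (leq_imset_card _ _).
apply/subsetP=> y; rewrite inE => uy.
have yp : y \in p.
  by have := mem_path y; rewrite inE => /orP[/eqP E|//]; rewrite E e_irr in uy.
have ip : index y p < size p by rewrite index_mem.
by apply/imsetP; exists (Ordinal ip); rewrite ?inE /= nth_index.
Qed.

Lemma card_end_nbrs : #|[set y | e v y]| <= #|end_nbrs|.
Proof.
suff /subset_leq_card le : [set y | e v y] \subset [set vx i | i : 'I_(size p) in end_nbrs].
  exact: leq_trans le (leq_imset_card _ _).
apply/subsetP=> y; rewrite inE => vy.
have ip : index y (u :: p) < size p.
  have := mem_path y; rewrite -index_mem /= ltnS leq_eqVlt => /orP[/eqP E|//].
  have := nth_index u (mem_path y); rewrite /= E nth_last /=.
  by rewrite last_p => vE; rewrite -vE e_irr in vy.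
by apply/imsetP; exists (Ordinal ip); rewrite ?inE /= nth_index ?mem_path // e_sym.
Qed.

Lemma rotation_hamiltonian s : perm_eq s (u :: p) -> cycle e s -> hamiltonian e.
Proof.
by move=> sp cs; exists s; rewrite (perm_uniq sp) (perm_size sp).
Qed.

Lemma crossing_hamiltonian i : i \in start_nbrs -> i \in end_nbrs -> hamiltonian e.
Proof.
rewrite !inE => iu iv; have [s [y [t [E _ Ls yE Lt]]]] := split_path (ltn_ord i).
apply: (@rotation_hamiltonian ((u :: s) ++ rev (y :: t))).
  by rewrite E -cat_cons perm_cat2l perm_rev.
apply: cycle_rotate2; rewrite ?yE // -?yE -?E //.
by rewrite Lt Ls.
Qed.

(** Ore's count: the two index sets are disjoint, since a crossing would close the path, and they
    live among the [#|T|.-1] edges of the path. *)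
Lemma nonhamiltonian_deg_sum : ~ hamiltonian e ->
  #|[set y | e u y]| + #|[set y | e v y]| < #|T|.
Proof.
move=> nh; rewrite -size_p /= ltnS.
apply: leq_trans (leq_add card_start_nbrs card_end_nbrs) _.
rewrite -cardsUI [_ :&: _](_ : _ = set0) ?cards0 ?addn0.
  by rewrite -[leqRHS]card_ord max_card.
apply/eqP; rewrite -subset0; apply/subsetP => i /setIP[iu iv].
by case: nh; apply: crossing_hamiltonian iu iv.
Qed.

End HamiltonianPath.

(** Bondy-Chvatal closure in three waves. In an edge-maximal counterexample [Hi] is a clique; so its
    members have degree at least [#|Hi|.-1], which with [d] forces every edge between [Hi] and the
    rest; so all remaining degrees reach [#|Hi|], at least half of [#|T|], and the graph is
    complete. *)
Lemma closure_hamiltonian (T : finType) (e : rel T) (Hi : {set T}) (d : nat) :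
  2 < #|T| -> symmetric e -> irreflexive e ->
  (forall x, d <= #|[set y | e x y]|) ->
  {in Hi, forall x, #|T| <= 2 * #|[set y | e x y]|} ->
  #|T| < d + #|Hi| -> #|T| <= 2 * #|Hi| -> hamiltonian e.
Proof.
move=> T3 e_sym e_irr deg degHi dHi Hi2.
pose Q (e : rel T) := (forall x, d <= #|[set y | e x y]|) /\
  {in Hi, forall x, #|T| <= 2 * #|[set y | e x y]|}.
have Qe : Q e by split.
refine (@maximal_nonhamiltonian _ Q T3 _ _ e e_sym e_irr Qe);
  move=> {e e_sym e_irr deg degHi Qe} e.
  move=> e' sub [deg degHi].
  have le x : #|[set y | e x y]| <= #|[set y | e' x y]|.
    by apply/subset_leq_card/subsetP=> y; rewrite !inE => /sub.
  split=> x; first exact: leq_trans (deg x) (le x).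
  by move=> /degHi h; apply: leq_trans h _; rewrite leq_mul2l le orbT.
move=> e_sym e_irr [deg degHi] nh hp.
have degS u v : u != v -> ~~ e u v -> #|[set y | e u y]| + #|[set y | e v y]| < #|T|.
  move=> uv nuv; have [p [pp lp Up Sp]] := hp u v uv nuv.
  exact: (nonhamiltonian_deg_sum e_sym e_irr pp lp Up Sp).
have HiC : {in Hi &, forall x y, x != y -> e x y}.
  move=> x y xH yH xy; apply: contraT => /(degS _ _ xy).
  by have := degHi x xH; have := degHi y yH; lia.
have HiD x : x \in Hi -> #|Hi| <= #|[set y | e x y]|.+1.
  move=> xH; rewrite (cardsD1 x Hi) xH ltnS; apply/subset_leq_card/subsetP=> y.
  by rewrite !inE => /andP[yx yH]; apply: HiC; rewrite // eq_sym.
have loHi x y : x \notin Hi -> y \in Hi -> e x y.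
  move=> xH yH; apply: contraT => nxy.
  have xy : x != y by apply: contraNneq xH => ->.
  by have := degS _ _ xy nxy; have := deg x; have := HiD y yH; lia.
have loD x : x \notin Hi -> #|Hi| <= #|[set y | e x y]|.
  by move=> xH; apply/subset_leq_card/subsetP=> y yH; rewrite inE loHi.
apply: nh; apply: complete_hamiltonian => [|x y xy]; first exact: ltnW.
have [xH|xH] := boolP (x \in Hi); have [yH|yH] := boolP (y \in Hi).
- exact: HiC.
- by rewrite e_sym loHi.
- exact: loHi.
apply: contraT => /(degS _ _ xy).
by have := loD x xH; have := loD y yH; lia.
Qed.

Lemma split_cycle (T : eqType) (c : seq T) y z : uniq c -> y \in c -> z \in c -> y != z ->
  exists i q r, rot i c = (next c y :: q) ++ next c z :: r /\
    last (next c y) q = z /\ last (next c z) r = y.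
Proof.
move=> uc yc zc yz; have ic : index y c < size c by rewrite index_mem.
move: (rot_index yc) ic => /=; move: (index y c) (_ ++ _) => i s rs ic.
have us : uniq (y :: s) by rewrite -rs rot_uniq.
rewrite -!(next_rot i uc) rs.
have zs : z \in s.
  by move: zc; rewrite -(mem_rot i) rs inE eq_sym (negPf yz).
case/splitPr: zs rs us => s1 s2 rs us.
have zs1 : z \notin s1.
  by move: us; rewrite /= cat_uniq /= => /and3P[_ _ /and3P[/norP[]]].
have ny : next (y :: s1 ++ z :: s2) y = head z (rcons s1 z).
  by rewrite next_nth mem_head /= eqxx; case: (s1).
have nz : next (y :: s1 ++ z :: s2) z = head y (rcons s2 y).
  rewrite next_nth inE mem_cat mem_head !orbT /= (negPf yz) index_cat (negPf zs1) /=.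
  by rewrite eqxx addn0 nth_cat ltnNge leqnSn /= subSnn; case: (s2).
exists i.+1, (behead (rcons s1 z)), (behead (rcons s2 y)).
rewrite ny nz; split; last by split; [case: (s1) => // a q; rewrite /= last_rcons|case: (s2) => // a q; rewrite /= last_rcons].
have E (x : T) q : head x (rcons q x) :: behead (rcons q x) = rcons q x by case: q.
rewrite -cat_cons !E.
by rewrite rotS // rs rot1_cons rcons_cat cat_rcons.
Qed.

(** * Degrees just below one half, with an edge between any two large sets *)

Section LinkedHalves.
Variables (T : finType) (e : rel T) (d l : nat).
Hypotheses (e_sym : symmetric e) (e_irr : irreflexive e).

Lemma insert_cycle x a q b r : cycle e ((a :: q) ++ b :: r) -> e a b ->
  e x (last a q) -> e x (last b r) -> cycle e (x :: rev (a :: q) ++ b :: r).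
Proof.
move=> cc ab xq xr; move: cc; rewrite cycle_catE => /and4P[pq _ pr _].
rewrite -cat_cons cycle_catE rev_belast_last /= xq path_rev_belast // pq.
by rewrite last_rev_belast ab pr e_sym.
Qed.

Hypothesis deg : forall x, d <= #|[set y | e x y]|.
Hypothesis linked : forall A B : {set T}, l <= #|A| -> l <= #|B| ->
  exists x y, [/\ x \in A, y \in B & e x y].
Hypotheses (le_ld : l <= d) (le_3d : l + #|T| <= 3 * d + 1).

(* If [x] is off the cycle, two successors of neighbours of [x] are adjacent,
   and rotating at them inserts [x]. *)
Lemma extend_cycle c : uniq c -> cycle e c -> 2 * d <= size c < #|T| ->
  exists c', [/\ uniq c', cycle e c' & size c' = (size c).+1].
Proof.
move=> uc cc /andP[dc cT].
have [x xc] : exists x, x \notin c.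
  apply/existsP; rewrite -negb_forall; apply: contraL cT => /forallP all_c.
  rewrite -leqNgt -(card_uniqP uc); apply/subset_leq_card/subsetP => y _.
  exact: all_c.
pose N := [set y in c | e x y].
(* At most [#|T| - 2 * d - 1] vertices other than [x] lie off the cycle, so [le_3d] leaves [x] at
   least [l] neighbours on it. *)
have cardN : l <= #|N|.
  have le : #|[set y | e x y]| <= #|N| + #|[set y | y \notin x :: c]|.
    apply: leq_trans (leq_card_setU _ _).
    apply/subset_leq_card/subsetP=> y; rewrite !inE => xy.
    rewrite xy andbT negb_or; case: (y \in c) => //=.
    by rewrite andbT; apply: contraTneq xy => ->; rewrite e_irr.
  have oc : #|[set y | y \notin x :: c]| + (size c).+1 = #|T|.
    rewrite -(cardsC [set y | y \in x :: c]) addnC; congr (_ + _).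
      by rewrite cardsE (card_uniqP _) //= xc.
    by apply: eq_card => y; rewrite !inE.
  have := deg x; lia.
have cardS : l <= #|[set next c y | y in N]|.
  rewrite card_in_imset // => y z; rewrite !inE => /andP[yc _] /andP[zc _] E.
  by rewrite -(prev_next uc y) E prev_next.
have [a [b [/imsetP[y yN ->] /imsetP[z zN ->] ab]]] := linked cardS cardS.
have yz : y != z by apply: contraTneq ab => ->; rewrite e_irr.
move: yN zN; rewrite !inE => /andP[yc xy] /andP[zc xz].
have [i [q [r [E [Lq Lr]]]]] := split_cycle uc yc zc yz.
exists (x :: rev (next c y :: q) ++ next c z :: r); split.
- have P : perm_eq (rev (next c y :: q) ++ next c z :: r) c.
    apply: perm_trans (_ : perm_eq (rot i c) c); last by rewrite perm_rot.
    by rewrite E perm_cat2r perm_rev.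
  by rewrite cons_uniq (perm_mem P) xc (perm_uniq P).
- by apply: insert_cycle; rewrite ?Lq ?Lr // -E rot_cycle.
- by rewrite -(size_rot i c) E /= !size_cat size_rev.
Qed.

Lemma long_cycle_hamiltonian c : uniq c -> cycle e c -> 2 * d <= size c ->
  hamiltonian e.
Proof.
have [n] := ubnP (#|T| - size c); elim: n c => // n IH c le uc cc dc.
have sc : size c <= #|T| by rewrite -(card_uniqP uc) max_card.
have [E|ne] := eqVneq (size c) #|T|; first by exists c.
have cT : size c < #|T| by rewrite ltn_neqAle ne.
have [|c' [uc' cc' sc']] := extend_cycle uc cc; first by rewrite dc.
by apply: IH uc' cc' _; rewrite sc'; lia.
Qed.

End LinkedHalves.

(* In an edge-maximal counterexample non-adjacent [u] and [v] are joined by a Hamilton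
   path.  If some neighbour of [v] precedes some predecessor of a neighbour of [u],
   a closest such pair gives a cycle through [2 * d] vertices; otherwise an edge
   linking the two ends closes the path up. *)
Lemma linked_halves_hamiltonian (T : finType) (e : rel T) (d l : nat) :
  2 < #|T| -> symmetric e -> irreflexive e ->
  (forall x, d <= #|[set y | e x y]|) ->
  (forall A B : {set T}, l <= #|A| -> l <= #|B| ->
    exists x y, [/\ x \in A, y \in B & e x y]) ->
  l <= d -> l + #|T| <= 3 * d + 1 -> hamiltonian e.
Proof.
move=> T3 e_sym e_irr deg linked le_ld le_3d.
pose Q (e : rel T) := (forall x, d <= #|[set y | e x y]|) /\
  forall A B : {set T}, l <= #|A| -> l <= #|B| ->
    exists x y, [/\ x \in A, y \in B & e x y].
have Qe : Q e by split.
refine (@maximal_nonhamiltonian _ Q T3 _ _ e e_sym e_irr Qe);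
  move=> {e e_sym e_irr deg linked Qe} e.
  move=> e' sub [deg linked]; split=> [x|A B lA lB].
    apply: leq_trans (deg x) _.
    by apply/subset_leq_card/subsetP=> y; rewrite !inE => /sub.
  by have [x [y [xA yB /sub xy]]] := linked A B lA lB; exists x, y.
move=> e_sym e_irr [deg linked] nh hp.
have [u [v [uv nuv]]] : exists u v, u != v /\ ~~ e u v.
  have [/existsP[u /existsP[v /andP[uv nuv]]]|] :=
    boolP [exists u, exists v, (u != v) && ~~ e u v]; first by exists u, v.
  move=> ne; case: nh; apply: complete_hamiltonian => [|x y xy]; first exact: ltnW.
  apply: contraT => nxy; case/existsP: ne; exists x; apply/existsP; exists y.
  by rewrite xy.
have [p [pp lp Up Sp]] := hp u v uv nuv.
pose X := start_nbrs e u p; pose B := end_nbrs e u v p.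
have dX : d <= #|X| := leq_trans (deg u) (card_start_nbrs e_irr Up Sp).
have dB : d <= #|B| := leq_trans (deg v) (card_end_nbrs e_sym e_irr lp Up Sp).
have XB i : i \in X -> i \in B -> False.
  move=> iX iB; apply: nh.
  exact: (crossing_hamiltonian e_sym pp lp Up Sp iX iB).
pose bad (ij : 'I_(size p) * 'I_(size p)) := [&& ij.1 \in B, ij.2 \in X & ij.1 < ij.2].
have [/existsP[ij0 bad0]|nbad] := boolP [exists ij, bad ij].
  case: (arg_minnP (fun ij : 'I_(size p) * 'I_(size p) => ij.2 - ij.1) bad0).
  case=> j i /and3P[/= jB iX ji] min_ij.
  (* No index strictly between a closest pair belongs to [X] or [B], as it would give a closer pair.
     The [i - j] vertices that the shortcut loses therefore leave a cycle of length at least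
     [#|X| + #|B|], hence [2 * d]. *)
  have gap : #|X| + #|B| + (i - j).-1 <= size p.
    pose M := [set h : 'I_(size p) | j < h < i].
    have -> : (i - j).-1 = #|M|.
      rewrite -[LHS]card_ord; symmetry.
      have lt (h : 'I_(i - j).-1) : j.+1 + h < size p.
        by have := ltn_ord h; have := ltn_ord i; lia.
      have inj : injective (fun h => Ordinal (lt h)).
        by move=> h h' [] /addnI/val_inj.
      rewrite -(card_imset _ inj); apply: eq_card => h; rewrite inE.
      apply/idP/imsetP => [/andP[jh hi]|[h' _ ->]] /=; last first.
        by have := ltn_ord h'; lia.
      have lth : h - j.+1 < (i - j).-1 by lia.
      by exists (Ordinal lth) => //; apply: val_inj; rewrite /= subnKC.
    rewrite -[leqRHS]card_ord.
    have -> : #|X| + #|B| = #|X :|: B|.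
      rewrite -cardsUI [X :&: B](_ : _ = set0) ?cards0 ?addn0 //.
      by apply/eqP; rewrite -subset0; apply/subsetP => h /setIP[hX hB]; case: (XB h).
    have -> : #|X :|: B| + #|M| = #|(X :|: B) :|: M|.
      rewrite -cardsUI [_ :&: M](_ : _ = set0) ?cards0 ?addn0 //.
      apply/eqP; rewrite -subset0; apply/subsetP => h /setIP[/setUP[] h1].
        rewrite inE => /andP[jh hi]; have := min_ij (j, h).
        by rewrite /bad /= jB h1 jh => /(_ isT); lia.
      rewrite inE => /andP[jh hi]; have := min_ij (h, i).
      by rewrite /bad /= iX h1 hi => /(_ isT); lia.
    exact: max_card.
  have jip : j < i < size p by rewrite ji ltn_ord.
  have [s [y [t [z [w [E St [Ls yE] [Lt zE] Lw]]]]]] := split_path3 lp jip.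
  move: iX jB; rewrite !inE -zE -Ls => uz sv.
  have szE : size (u :: p) = size (u :: s) + size (y :: t) + size (z :: w).
    by rewrite E /= size_cat /= size_cat /=; lia.
  apply: nh; apply: (@long_cycle_hamiltonian _ e d l e_sym e_irr deg linked le_ld le_3d
    ((u :: s) ++ rev (z :: w))).
  - have P : perm_eq ((u :: s) ++ rev (z :: w)) ((u :: s) ++ z :: w).
      by rewrite perm_cat2l perm_rev.
    rewrite (perm_uniq P); apply: subseq_uniq Up; rewrite E -cat_cons.
    exact: cat_subseq (subseq_refl _) (suffix_subseq (y :: t) (z :: w)).
  - by apply: (cycle_shortcut e_sym (y := y) (t := t)); rewrite -?E // Lw.
  - rewrite size_cat size_rev; move: szE; rewrite St /=; lia.
have nbadP i j : j \in B -> i \in X -> i < j.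
  move=> jB iX; rewrite ltnNge leq_eqVlt; apply/negP => /orP[/eqP/val_inj E|ji].
    by apply: (XB i) => //; rewrite -E.
  by case/existsP: nbad; exists (j, i); rewrite /bad /= jB iX.
have vx_inj i j : i <= size p -> j <= size p ->
    nth u (u :: p) i = nth u (u :: p) j -> i = j.
  by move=> ip jp /eqP; rewrite nth_uniq // => /eqP.
(* Now all of [X] precedes all of [B]. An edge from position [i] in [X] to the position after [j] in
   [B] supplies the third chord of [cycle_rotate3]. *)
pose X' := [set nth u (u :: p) i | i : 'I_(size p) in X].
pose B' := [set nth u (u :: p) i.+1 | i : 'I_(size p) in B].
have lX : l <= #|X'|.
  rewrite card_in_imset; first exact: leq_trans dX.
  by move=> i j _ _ /vx_inj E; apply/val_inj/E; apply: ltnW.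
have lB : l <= #|B'|.
  rewrite card_in_imset; first exact: leq_trans dB.
  by move=> i j _ _ /vx_inj E; apply/val_inj/succn_inj/E.
have [_ [_ [/imsetP[i iX ->] /imsetP[j jB ->] ij]]] := linked _ _ lX lB.
have ijp : i < j < size p by rewrite (nbadP _ _ jB iX) ltn_ord.
have [s [y [t [z [w [E St [Ls yE] [Lt zE] Lw]]]]]] := split_path3 lp ijp.
move: iX jB; rewrite !inE -yE -Lt => uy tv.
apply: nh; apply: (@rotation_hamiltonian _ _ u p Up Sp ((u :: s) ++ (z :: w) ++ rev (y :: t))).
  rewrite E -cat_cons perm_cat2l perm_catC -[y :: t ++ _]cat_cons perm_cat2r.
  by rewrite perm_rev.
apply: (cycle_rotate3 e_sym) => //; first by rewrite -E.
  by rewrite Ls zE.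
by rewrite Lw.
Qed.

(** * Random partitions into blocks *)

Section RandomBlocks.
Variables (V : finType) (t m : nat).

(** One injectivity makes the blocks repetition-free and pairwise disjoint; covering follows by
    counting when [#|V| = t * m]. *)
Definition blocks (b : 'I_t -> m.-tuple V) : Prop :=
  injective (fun ij : 'I_t * 'I_m => tnth (b ij.1) ij.2).

Variables (phi : 'I_t * 'I_m -> V) (i0 : 'I_t).
Hypothesis phi_inj : injective phi.
Implicit Types (s : {perm V}) (F : {set m.-tuple V}).

Definition perm_block s (i : 'I_t) : m.-tuple V := [tuple s (phi (i, j)) | j < m].

Lemma perm_block_inj s : blocks (perm_block s).
Proof.
by move=> [i j] [i' j'] /=; rewrite !tnth_mktuple => /perm_inj/phi_inj[-> ->].
Qed.

Lemma card_perm_agree (U : {set V}) (s0 : {perm V}) :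
  #|[set s : {perm V} | [forall x in U, s x == s0 x]]| <= (#|V| - #|U|)`!.
Proof.
have <- : #|~: U| = #|V| - #|U| by rewrite -(cardsC U) addKn.
rewrite -(card_perm (~: U)).
rewrite -(card_imset _ (mulIg s0^-1%g)); apply/subset_leq_card/subsetP => _ /imsetP[s + ->].
rewrite inE => /forallP agree; apply/subsetP => x; rewrite !inE permM.
by apply: contra => xU; have := agree x; rewrite xU => /eqP->; rewrite permK.
Qed.

(** Prescribing the blocks indexed by [J] fixes the permutation on [#|J| * m] points, and there are
    at most [#|F| ^ #|J|] prescriptions. *)
Lemma card_perm_blocks_in (J : {set 'I_t}) F :
  #|[set s | [forall j in J, perm_block s j \in F]]| <=
    #|F| ^ #|J| * (#|V| - #|J| * m)`!.
Proof.
set S := [set s | _]; pose t0 := perm_block 1 i0.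
pose h s := [ffun j => if j \in J then perm_block s j else t0].
have hS s : s \in S -> h s \in pffun_on t0 (mem J) (mem F).
  rewrite inE => /forallP sF; apply/pffun_onP; split.
    by apply/supportP => j /negPf jJ; rewrite ffunE jJ.
  by move=> _ /imageP[j jJ ->]; rewrite ffunE; have := sF j; have -> : j \in J by [].
rewrite -sum1_card (partition_big h (mem (pffun_on t0 (mem J) (mem F)))) //=.
rewrite -(card_pffun_on t0) -sum_nat_const; apply: leq_sum => f _.
rewrite sum1_card; set A := fun s => _.
have [s0 /andP[s0S /eqP s0f]|A0] := pickP A; last by rewrite eq_card0.
pose U := [set phi ij | ij in setX J [set: 'I_m]].
have <- : #|U| = #|J| * m by rewrite card_imset // cardsX cardsT card_ord.
apply: leq_trans (card_perm_agree U s0); apply/subset_leq_card/subsetP => s.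
rewrite unfold_in /= => /andP[sS /eqP sf]; rewrite inE; apply/forallP => x.
apply/implyP => /imsetP[[j l]]; rewrite inE => /andP[/= jJ _] ->.
have := congr1 (fun f : {ffun 'I_t -> m.-tuple V} => tnth (f j) l) (etrans sf (esym s0f)).
by rewrite /= !ffunE jJ !tnth_mktuple => ->.
Qed.

(** A factorial moment: the binomial counts the [r]-sets of indices whose blocks all lie in [F], and
    the double sum is exchanged. *)
Lemma sum_bin_blocks F r :
  \sum_(s : {perm V}) 'C(#|[set i | perm_block s i \in F]|, r) <=
    'C(t, r) * (#|F| ^ r * (#|V| - r * m)`!).
Proof.
have -> : \sum_(s : {perm V}) 'C(#|[set i | perm_block s i \in F]|, r) =
    \sum_(s : {perm V}) \sum_(J : {set 'I_t} | #|J| == r)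
      (J \subset [set i | perm_block s i \in F]).
  apply: eq_bigr => s _; rewrite -cards_draws -sum1dep_card.
  rewrite (eq_bigl _ _ (fun J => andbC _ _)) big_mkcondr /=.
  by apply: eq_bigr => J _; case: (J \subset _).
rewrite exchange_big /= -[t in 'C(t, r)]card_ord -card_draws -sum1dep_card big_distrl /=.
apply: leq_sum => J /eqP <-; rewrite mul1n; apply: leq_trans (card_perm_blocks_in J F).
rewrite -big_mkcond sum1dep_card; apply/subset_leq_card/subsetP => s; rewrite !inE.
move=> /subsetP JF; apply/forallP => j; apply/implyP => /JF; by rewrite inE.
Qed.

End RandomBlocks.

Lemma leq_exp_ffact n r : (n - r) ^ r <= n ^_ r.
Proof.
elim: r n => // r IH [|n]; first by rewrite sub0n exp0n.
rewrite subSS ffactSS expnS leq_mul //; first by rewrite (leq_trans (leq_subr _ _)).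
Qed.

Lemma ffact_leq_exp n r : n ^_ r <= n ^ r.
Proof.
elim: r n => // r IH [|n] //; rewrite ffactSS expnS leq_mul //.
by apply: leq_trans (IH n) _; case: r {IH} => // r; rewrite leq_exp2r.
Qed.

Local Open Scope ring_scope.

Lemma bernoulli (R : realDomainType) (h : R) n : -1 <= h -> 1 + n%:R * h <= (1 + h) ^+ n.
Proof.
move=> h1; elim: n => [|n IH]; first by rewrite expr0 mul0r addr0.
have h0 : 0 <= 1 + h by lra.
rewrite exprS; apply: le_trans (ler_wpM2l h0 IH); rewrite -natr1.
have : 0 <= n%:R * (h * h) by rewrite mulr_ge0 ?ler0n // -expr2 sqr_ge0.
lra.
Qed.

(* Markov's inequality for the [r]-th factorial moment of the number of blocks lying
   in [F]; taking [r] linear in [t] makes the tail exponentially small. *)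
Lemma perm_block_tail (R : realFieldType) (V : finType) (t m r : nat)
    (phi : 'I_t * 'I_m -> V) (F : {set m.-tuple V}) (eta theta : R) :
  (0 < m)%N -> (0 < t)%N -> (0 < r)%N -> #|V| = (t * m)%N -> injective phi ->
  0 < eta -> r%:R <= theta * t%:R -> (1 + m)%:R * theta <= eta / 2 ->
  #|[set s : {perm V} | (#|F|%:R / #|V|%:R ^+ m + eta) * t%:R <
       #|[set i | perm_block phi s i \in F]|%:R]|%:R * (1 + eta / 2) ^+ r
    <= #|V|`!%:R :> R.
Proof.
move=> m0 t0 r0 cV phi_inj eta0 rt mtheta; set p := _ / _.
set bad := [set s | _]; set N := #|bad|%:R.
have i0 : 'I_t := Ordinal t0.
have n0 : (0 < #|V|)%N by rewrite cV muln_gt0 t0.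
have eta2 : 0 <= eta / 2 by rewrite divr_ge0 // ltW.
have tR : 0 < t%:R :> R by rewrite ltr0n.
have nR : 0 < #|V|%:R :> R by rewrite ltr0n.
have p0 : 0 <= p by rewrite divr_ge0 ?exprn_ge0 ?ler0n.
have [p1|p1] := ltP 1 (p + eta).
  rewrite /N /bad (_ : [set s | _] = set0) ?cards0 ?mul0r ?ler0n //.
  apply/setP => s; rewrite !inE; apply/negP => /lt_le_trans/(_ (_ : _ <= t%:R)) H.
  have : (p + eta) * t%:R < 1 * t%:R.
    by rewrite mul1r H // ler_nat -[leqRHS]card_ord max_card.
  by rewrite ltr_pM2r // => /lt_trans/(_ p1); rewrite ltxx.
have theta0 : 0 <= theta.
  by rewrite -(pmulr_lge0 _ tR) (le_trans _ rt) ?ler0n.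
have theta1 : theta <= 1.
  have : 0 <= m%:R * theta by rewrite mulr_ge0 ?ler0n.
  by move: mtheta; rewrite natrD mulrDl; lra.
have rt' : (r <= t)%N.
  rewrite -(ler_nat R); apply: le_trans rt _.
  by rewrite -[leRHS]mul1r ler_wpM2r // ltW.
have rmn : (r * m <= #|V|)%N by rewrite cV leq_mul2r rt' orbT.
(* On the bad event the count exceeds $(p+\eta)t$ while $r\le\theta t$, so each factor of its $r$-th
   falling factorial is at least $at$. *)
pose a := p + eta - theta.
have a0 : 0 <= a.
  have : 0 <= m%:R * theta by rewrite mulr_ge0 ?ler0n.
  by move: mtheta; rewrite /a natrD mulrDl; lra.
have stepA : N * (a * t%:R) ^+ r <=
    (t ^ r * (#|F| ^ r * (#|V| - r * m)`!))%:R.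
  apply: le_trans (_ : (\sum_(s : {perm V})
    'C(#|[set i | perm_block phi s i \in F]|, r) * r`!)%:R <= _); last first.
    rewrite ler_nat -big_distrl /=.
    apply: leq_trans (leq_mul (sum_bin_blocks i0 phi_inj F r) (leqnn _)) _.
    by rewrite mulnAC bin_ffact leq_mul2r ffact_leq_exp orbT.
  rewrite natr_sum /N -sum1_card natr_sum mulr_suml.
  rewrite [leRHS](bigID (mem bad)) /= -[leLHS]addr0 lerD //; last first.
    by apply: sumr_ge0 => s _; rewrite ler0n.
  apply: ler_sum => s; rewrite inE => badS; rewrite mul1r bin_ffact.
  apply: le_trans (_ : ((#|[set i | perm_block phi s i \in F]| - r) ^ r)%:R <= _).
    rewrite natrX lerXn2r ?nnegrE ?ler0n ?mulr_ge0 ?ler0n //.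
    have H : a * t%:R <= #|[set i | perm_block phi s i \in F]|%:R - r%:R.
      by move: badS rt; rewrite /a mulrBl => /ltW; lra.
    apply: le_trans H _; by rewrite lerBlDr -natrD ler_nat addnC -leq_subLR.
  by rewrite ler_nat leq_exp_ffact.
have stepB : N * (a * t%:R) ^+ r * ((#|V| - r * m) ^ (r * m))%:R <=
    (t ^ r * #|F| ^ r * #|V|`!)%:R.
  apply: le_trans (ler_wpM2r (ler0n _ _) stepA) _.
  rewrite -natrM ler_nat -mulnA -!mulnA !leq_mul2l mulnC.
  by rewrite -(ffact_fact rmn) leq_mul2r leq_exp_ffact !orbT.
have base : (1 - m%:R * theta) * #|V|%:R ^+ m <= (#|V| - r * m)%:R ^+ m :> R.
  apply: le_trans (_ : ((1 - theta) * #|V|%:R) ^+ m <= _).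
    rewrite exprMn ler_wpM2r ?exprn_ge0 ?ler0n //.
    have th1 : -1 <= - theta by lra.
    by have := bernoulli m th1; rewrite mulrN.
  rewrite lerXn2r ?nnegrE ?ler0n ?mulr_ge0 ?ler0n ?subr_ge0 //.
  rewrite natrB // cV !natrM; have m0' : 0 <= m%:R :> R by rewrite ler0n.
  have := ler_wpM2r m0' rt; lra.
(* Two losses, $\theta$ from the falling factorial and $m\theta$ from [base], together take at most
   $\eta/2$. *)
have amt : p + eta / 2 <= a * (1 - m%:R * theta).
  have a1 : a <= 1 by rewrite /a; lra.
  have mt0 : 0 <= m%:R * theta by rewrite mulr_ge0 ?ler0n.
  have : a * (m%:R * theta) <= 1 * (m%:R * theta) by rewrite ler_wpM2r.
  by move: mtheta; rewrite natrD mulrDl /a; lra.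
clearbody a; have mt1 : 0 <= 1 - m%:R * theta.
  by move: mtheta; rewrite natrD mulrDl mul1r; lra.
have tnm : 0 < (t%:R * #|V|%:R ^+ m) ^+ r :> R by rewrite exprn_gt0 // mulr_gt0 // exprn_gt0.
have main : N * (p + eta / 2) ^+ r <= p ^+ r * #|V|`!%:R.
  rewrite -(ler_pM2r tnm) mulrAC -[leLHS]mulrA -exprMn.
  apply: le_trans (_ : N * (a * t%:R) ^+ r * ((#|V| - r * m) ^ (r * m))%:R <= _).
    rewrite -[leRHS]mulrA natrX exprM exprAC -exprMn.
    apply: ler_wpM2l; first exact: ler0n.
    rewrite lerXn2r ?nnegrE ?mulr_ge0 ?exprn_ge0 ?ler0n ?addr_ge0 //.
    apply: le_trans (_ : a * t%:R * ((1 - m%:R * theta) * #|V|%:R ^+ m) <= _); last first.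
      by rewrite ler_wpM2l // mulr_ge0 // ltW.
    have tnm1 : 0 <= t%:R * #|V|%:R ^+ m :> R by rewrite mulr_ge0 ?exprn_ge0 // ltW.
    apply: le_trans (ler_wpM2l tnm1 amt) _; rewrite le_eqVlt; apply/orP; left.
    by apply/eqP; ring.
  apply: le_trans stepB _.
  rewrite mulrAC -exprMn !natrM !natrX -exprMn.
  rewrite ler_wpM2r ?ler0n // lerXn2r ?nnegrE ?mulr_ge0 ?invr_ge0 ?exprn_ge0 ?ler0n //.
  by rewrite [p * _]mulrCA /p divfK // expf_neq0 // gt_eqF.
(* For [p = 0], [main] already forces [N = 0]. Otherwise it is divided by [p ^+ r], using
   $p(1+\eta/2)\le p+\eta/2$ for $p\le 1$. *)
have [pz|pnz] := eqVneq p 0.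
  move: main; rewrite pz add0r expr0n (gtn_eqF r0) mul0r => N0.
  have : N <= 0.
    rewrite -(ler_pM2r (_ : 0 < (eta / 2) ^+ r)) ?mul0r //.
    by rewrite exprn_gt0 // divr_gt0.
  rewrite le_eqVlt ltNge ler0n orbF => /eqP ->; by rewrite mul0r ler0n.
have pp : 0 < p by rewrite lt_def pnz.
rewrite -(ler_pM2l (_ : 0 < p ^+ r)) ?exprn_gt0 // (le_trans _ main) //.
rewrite mulrCA -exprMn ler_wpM2l ?ler0n // lerXn2r ?nnegrE ?mulr_ge0 ?addr_ge0 //.
- by rewrite invr_ge0 exprn_ge0 ?ler0n.
- have p1' : p <= 1 by lra.
  by rewrite mulrDr mulr1 lerD2l; have := ler_wpM2r eta2 p1'; rewrite mul1r.
Qed.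

(** Bernoulli makes $(1+h)^q$ at least linear in $t$ when $q$ is; the power $C+1$ of this beats
    $n^C$, whence the choice $r=q(C+1)$. *)
Lemma exp_beats_poly (R : realType) (C m : nat) (h theta : R) : 0 < h -> 0 < theta -> (0 < m)%N ->
  exists n1 : nat, forall t : nat, (n1 <= t * m)%N -> exists r : nat,
    [/\ (0 < r)%N, r%:R <= theta * t%:R & (t * m)%:R ^+ C < (1 + h) ^+ r].
Proof.
move=> h0 th0 m0.
(* $\lambda n$ is $h$ times half of $\theta t/(C+1)$; the half pays for rounding [q] down. *)
pose lam := theta * h / (C.+1 * m)%:R / 2.
have Cm0 : 0 < (C.+1 * m)%:R :> R by rewrite ltr0n muln_gt0.
have lam0 : 0 < lam by rewrite !divr_gt0 // mulr_gt0.
pose x0 := 2 * (C.+1 * m)%:R * 2 / theta.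
exists (maxn (Num.truncn x0).+1 (Num.truncn ((lam ^+ C.+1)^-1)).+1) => t.
rewrite geq_max => /andP[n1 n2]; set n := (t * m)%N in n1 n2 *.
have nx0 : x0 < n%:R by apply: lt_le_trans (truncnS_gt _) _; rewrite ler_nat.
have nlam : (lam ^+ C.+1)^-1 < n%:R.
  by apply: lt_le_trans (truncnS_gt _) _; rewrite ler_nat.
pose q := Num.truncn (theta * t%:R / C.+1%:R).
have C0 : 0 < C.+1%:R :> R by rewrite ltr0n.
have q1 : q%:R <= theta * t%:R / C.+1%:R.
  by rewrite truncn_le // divr_ge0 ?mulr_ge0 ?ler0n // ltW.
have mR : 0 < m%:R :> R by rewrite ltr0n.
have big : 4 < theta * t%:R / C.+1%:R.
  move: nx0; rewrite /x0 /n ltr_pdivrMr // natrM natrM => H.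
  rewrite ltr_pdivlMr // -(ltr_pM2r mR); lra.
have q2 : theta * t%:R / C.+1%:R / 2 <= q%:R.
  have half (x y : R) : 4 < x -> x < y + 1 -> x / 2 <= y by lra.
  by apply: half big _; rewrite natr1; apply: truncnS_gt.
exists (q * C.+1)%N; split.
- rewrite muln_gt0 andbT -(ltr_nat R); apply: lt_le_trans q2.
  by rewrite divr_gt0 // (lt_trans _ big).
- by rewrite natrM -ler_pdivlMr.
rewrite exprM; apply: lt_le_trans (_ : (lam * n%:R) ^+ C.+1 <= _).
  rewrite exprMn [n%:R ^+ C.+1]exprS mulrA -{1}[n%:R ^+ C]mul1r ltr_pM2r.
    by rewrite -ltr_pdivrMl ?mulr1 // exprn_gt0.
  by apply: exprn_gt0; apply: le_lt_trans nlam; rewrite invr_ge0 exprn_ge0 // ltW.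
have [lam0' h0'] : 0 <= lam /\ 0 <= h by split; apply: ltW.
have lamn : 0 <= lam * n%:R by apply: mulr_ge0.
have h10 : 0 <= 1 + h by apply: addr_ge0.
rewrite lerXn2r ?nnegrE ?exprn_ge0 //.
have h1 : -1 <= h by lra.
apply: le_trans _ (bernoulli q h1).
have -> : lam * n%:R = h * (theta * t%:R / C.+1%:R / 2).
  rewrite /lam /n !natrM; move: C0 mR; move: (C.+1%:R) (m%:R) => c d c0 d0.
  by field; rewrite !gt_eqF.
by apply: le_trans (ler_wpM2l h0' q2) _; rewrite [h * _]mulrC lerDr.
Qed.

(** A union bound: each family is bad for at most a fraction $(1+\eta/2)^{-r}$ of the permutations,
    and $(1+\eta/2)^r$ exceeds the number of families. Only upper bounds come out; lower ones are
    recovered later by listing complements too. *)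
Lemma sampling (R : realType) (C m : nat) (eta : R) : (0 < m)%N -> 0 < eta ->
  exists n1 : nat, forall (V : finType) (t : nat), (0 < t)%N -> (n1 <= #|V|)%N ->
    #|V| = (t * m)%N ->
  forall (L : finType) (F : L -> {set m.-tuple V}), (#|L| <= #|V| ^ C)%N ->
  exists2 b : 'I_t -> m.-tuple V, blocks b &
    forall l : L, #|[set i | b i \in F l]|%:R
      <= (#|F l|%:R / #|V|%:R ^+ m + eta) * t%:R.
Proof.
move=> m0 eta0; pose theta := eta / 2 / (1 + m)%:R.
have m1R : 0 < (1 + m)%:R :> R by rewrite ltr0n.
have th0 : 0 < theta by rewrite !divr_gt0.
have eta2 : 0 < eta / 2 by rewrite divr_gt0.
have [n1 n1P] := exp_beats_poly C eta2 th0 m0.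
exists n1 => V t t0 nV cV L F cL.
rewrite cV in nV; have [r [r0 rt rC]] := n1P t nV.
have [phi phi_inj] : exists phi : 'I_t * 'I_m -> V, injective phi.
  have c : #|{: 'I_t * 'I_m}| = #|V| by rewrite card_prod !card_ord.
  exists (fun x => enum_val (cast_ord c (enum_rank x))).
  exact: (inj_comp enum_val_inj (inj_comp (@cast_ord_inj _ _ c) enum_rank_inj)).
pose bad l := [set s : {perm V} | (#|F l|%:R / #|V|%:R ^+ m + eta) * t%:R <
       #|[set i | perm_block phi s i \in F l]|%:R].
have badP l : #|bad l|%:R * (1 + eta / 2) ^+ r <= #|V|`!%:R :> R.
  apply: perm_block_tail rt _ => //.
  by rewrite /theta mulrC divfK // gt_eqF.
have [s sP] : exists s : {perm V}, s \notin \bigcup_l bad l.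
  apply/existsP; rewrite -negb_forall; apply/negP => /forallP all_bad.
  have cT : (#|V|`! <= \sum_l #|bad l|)%N.
    have <- : #|perm_on [set: V]| = #|V|`! by rewrite card_perm cardsT.
    apply: leq_trans (_ : #|\bigcup_l bad l| <= _)%N.
      by apply/subset_leq_card/subsetP => s _; apply: all_bad.
    elim/big_ind2: _ => [|A a B b lA lB|//]; first by rewrite cards0.
    by rewrite cardsU; apply: leq_trans (leq_subr _ _) (leq_add lA lB).
  have e0 : 0 < (1 + eta / 2) ^+ r by rewrite exprn_gt0 // addr_gt0.
  have : #|V|`!%:R * (1 + eta / 2) ^+ r <= #|L|%:R * #|V|`!%:R :> R.
    apply: le_trans (_ : (\sum_l #|bad l|)%:R * (1 + eta / 2) ^+ r <= _).
      by rewrite ler_pM2r // ler_nat.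
    rewrite natr_sum mulr_suml mulr_natl -sumr_const; apply: ler_sum => l _.
    exact: badP.
  rewrite mulrC ler_pM2r ?ltr0n ?fact_gt0 // leNgt => /negP; apply.
  by apply: le_lt_trans rC; rewrite -natrX ler_nat -cV.
exists (perm_block phi s); first exact: perm_block_inj.
move=> l; rewrite leNgt; apply: contra sP => sl.
by apply/bigcupP; exists l; rewrite ?inE.
Qed.

(** * Averages and parity structure *)

Section Average.
Variable R : realFieldType.
Implicit Types (T U V : finType).

Definition avg T (F : T -> R) : R := (\sum_x F x) / #|T|%:R.

Lemma eq_avg T (F G : T -> R) : F =1 G -> avg F = avg G.
Proof. by move=> FG; rewrite /avg (eq_bigr _ (fun x _ => FG x)). Qed.

Lemma le_avg T (F G : T -> R) : (forall x, F x <= G x) -> avg F <= avg G.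
Proof.
by move=> FG; rewrite ler_wpM2r ?invr_ge0 ?ler0n // ler_sum // => x _.
Qed.

Lemma avg_ge0 T (F : T -> R) : (forall x, 0 <= F x) -> 0 <= avg F.
Proof. by move=> F0; rewrite divr_ge0 ?ler0n // sumr_ge0. Qed.

Lemma avgD T (F G : T -> R) : avg (fun x => F x + G x) = avg F + avg G.
Proof. by rewrite /avg big_split mulrDl. Qed.

Lemma avgZ T (c : R) (F : T -> R) : avg (fun x => c * F x) = c * avg F.
Proof. by rewrite /avg -mulr_sumr mulrA. Qed.

Lemma avgZr T (c : R) (F : T -> R) : avg (fun x => F x * c) = avg F * c.
Proof. by rewrite /avg -mulr_suml mulrAC. Qed.

Lemma avg_const T (c : R) : (0 < #|T|)%N -> avg (fun _ : T => c) = c.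
Proof.
by move=> T0; rewrite /avg sumr_const -[c *+ _]mulr_natr mulfK // pnatr_eq0 -lt0n.
Qed.

Lemma avg_exchange T U (F : T -> U -> R) :
  avg (fun x => avg (fun y => F x y)) = avg (fun y => avg (fun x => F x y)).
Proof.
by rewrite /avg -!mulr_suml exchange_big /= -!mulrA [_^-1 * _]mulrC.
Qed.

Lemma avg_le_exists T (F : T -> R) c : (0 < #|T|)%N -> avg F <= c -> exists x, F x <= c.
Proof.
move=> T0 Fc; apply/existsP; apply: contraLR Fc; rewrite negb_exists -ltNge.
move=> /forallP F_gt; rewrite -[c](@avg_const T) //.
have T0R : 0 < #|T|%:R^-1 :> R by rewrite invr_gt0 ltr0n.
rewrite /avg ltr_pM2r // -subr_gt0 -sumrB.
have /card_gt0P[x _] := T0.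
rewrite (bigD1 x) //= ltr_wpDr // ?subr_gt0 ?ltNge //.
by apply: sumr_ge0 => y _; rewrite subr_ge0 ltW // ltNge.
Qed.

Lemma avg_pred T (P : pred T) :
  avg (fun x => (P x)%:R) = #|[set x | P x]|%:R / #|T|%:R.
Proof.
rewrite /avg -sum1dep_card natr_sum [in RHS]big_mkcond /=; congr (_ / _).
by apply: eq_bigr => x _; case: (P x).
Qed.

Lemma avg_tuple0 V (F : 0.-tuple V -> R) : avg F = F [tuple].
Proof.
rewrite (eq_avg (G := fun=> F [tuple])) => [|s]; last by rewrite tuple0.
by rewrite avg_const // card_tuple.
Qed.

(** [F] takes plain sequences, so that peeling off an entry needs no cast between tuple lengths. *)
Lemma avg_tuple_cons V L (F : seq V -> R) :
  avg (fun s : L.+1.-tuple V => F s) =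
  avg (fun x : V => avg (fun s : L.-tuple V => F (x :: s))).
Proof.
rewrite /avg -mulr_suml -mulrA -invfM !card_tuple expnSr natrM; congr (_ / _).
rewrite pair_bigA /= (reindex (fun p : V * L.-tuple V => [tuple of p.1 :: p.2])) //=.
exists (fun s : L.+1.-tuple V => (thead s, [tuple of behead s])) => [[x s] _|s _] /=.
  by congr pair; apply: val_inj.
by rewrite -tuple_eta.
Qed.

Lemma avg_tuple_cat V a b (F : seq V -> R) :
  avg (fun s : (a + b).-tuple V => F s) =
  avg (fun s : a.-tuple V => avg (fun t : b.-tuple V => F (s ++ t))).
Proof.
elim: a F => [|a IH] F; first by rewrite avg_tuple0.
rewrite -[(a.+1 + b)%N]/(a + b).+1 avg_tuple_cons.
rewrite (avg_tuple_cons _ (fun s => avg (fun t : b.-tuple V => F (s ++ t)))).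
by apply: eq_avg => x; rewrite (IH (fun s => F (x :: s))).
Qed.

End Average.

Section Replacement.
Variables (R : realFieldType) (V : finType).
Hypothesis V0 : (0 < #|V|)%N.
Implicit Types (f g q : seq V -> bool) (chi : pred V).

Definition perm_invariant f := forall s t : seq V, perm_eq s t -> f s = f t.

Lemma card_tuple_gt0 L : (0 < #|{: L.-tuple V}|)%N.
Proof. by rewrite card_tuple expn_gt0 V0. Qed.

Lemma avg_tuple_const L (c : R) : avg (fun _ : L.-tuple V => c) = c.
Proof. exact: avg_const (card_tuple_gt0 L). Qed.

Lemma replace_prefix q L (d : R) : perm_invariant q ->
  avg (fun x => avg (fun y => avg (fun s : L.-tuple V => (q (x :: s) != q (y :: s))%:R))) <= d ->
  forall a b, (a + b)%N = L.+1 ->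
  avg (fun u : a.-tuple V => avg (fun v : a.-tuple V => avg (fun w : b.-tuple V =>
    (q (u ++ w) != q (v ++ w))%:R))) <= a%:R * d.
Proof.
move=> q_perm hyp; elim=> [|a IH] b abL.
  rewrite !avg_tuple0 mul0r le_eqVlt; apply/orP; left; apply/eqP.
  by rewrite -[RHS](avg_tuple_const b); apply: eq_avg => w; rewrite eqxx.
have {abL} abL : L = (a + b)%N by case: abL.
rewrite (avg_tuple_cons _ (fun u => avg (fun v : a.+1.-tuple V => avg (fun w : b.-tuple V =>
    (q (u ++ w) != q (v ++ w))%:R)))).
rewrite (eq_avg (G := fun x => avg (fun y => avg (fun u : a.-tuple V =>
    avg (fun v : a.-tuple V => avg (fun w : b.-tuple V =>
    (q (x :: u ++ w) != q (y :: v ++ w))%:R)))))); last first.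
  move=> x; rewrite [RHS]avg_exchange; apply: eq_avg => u.
  exact: (avg_tuple_cons _ (fun v => avg (fun w : b.-tuple V =>
    (q (x :: u ++ w) != q (v ++ w))%:R))).
apply: le_trans (_ : avg (fun x => avg (fun y => avg (fun u : a.-tuple V =>
    avg (fun v : a.-tuple V => avg (fun w : b.-tuple V =>
    (q (x :: u ++ w) != q (y :: u ++ w))%:R +
    (q (u ++ y :: w) != q (v ++ y :: w))%:R))))) <= _).
  do 5!apply: le_avg => ?; rewrite -natrD ler_nat.
  set s1 := _ :: _; rewrite -(q_perm _ _ (permEl (perm_catCA [:: _] _ _))) /=.
  rewrite -(q_perm _ _ (permEl (perm_catCA [:: _] _ _))) /=.
  by case: (q _); case: (q _); case: (q _).
rewrite -natr1 mulrDl mul1r addrC.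
under eq_avg => x do under eq_avg => y do under eq_avg => u do under eq_avg => v do rewrite avgD.
under eq_avg => x do under eq_avg => y do under eq_avg => u do rewrite avgD avg_tuple_const.
under eq_avg => x do under eq_avg => y do rewrite avgD.
under eq_avg => x do rewrite avgD.
rewrite avgD; apply: lerD.
  subst L; move: hyp; apply: le_trans; apply: le_avg => x; apply: le_avg => y.
  by rewrite (avg_tuple_cat a b (fun s => (q (x :: s) != q (y :: s))%:R)).
rewrite avg_const //; apply: le_trans (IH b.+1 _); last by rewrite addnS -abL.
rewrite avg_exchange; apply: le_avg => u; rewrite avg_exchange; apply: le_avg => v.
by rewrite (avg_tuple_cons _ (fun w => (q (u ++ w) != q (v ++ w))%:R)).
Qed.

Lemma replace_all q L (d : R) : perm_invariant q ->
  avg (fun x => avg (fun y => avg (fun s : L.-tuple V => (q (x :: s) != q (y :: s))%:R))) <= d ->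
  avg (fun u : L.+1.-tuple V => avg (fun v : L.+1.-tuple V => (q u != q v)%:R))
    <= L.+1%:R * d.
Proof.
move=> q_perm hyp; apply: le_trans (replace_prefix q_perm hyp (addn0 _)).
apply: le_avg => u; apply: le_avg => v.
by rewrite avg_tuple0 !cats0.
Qed.

(** The sum of vertex labels modulo 2. When [chi] is membership in $A$ and [s] enumerates $e$, this
    is the parity of $|e\cap A|$. *)
Definition chi_odd chi (s : seq V) := odd (count chi s).

Lemma chi_odd_cons chi x s : chi_odd chi (x :: s) = chi x (+) chi_odd chi s.
Proof. by rewrite /chi_odd /= oddD oddb. Qed.

Lemma chi_odd_cat chi s t : chi_odd chi (s ++ t) = chi_odd chi s (+) chi_odd chi t.
Proof. by rewrite /chi_odd count_cat oddD. Qed.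

Lemma chi_odd_perm chi : perm_invariant (chi_odd chi).
Proof. by move=> s t /seq.permP E; rewrite /chi_odd E. Qed.

(** Some fixed [p] is as good as the average. With the labels [f (x :: p)], the sum of [f] and
    [chi_odd] hardly changes when one entry is replaced, so [replace_all] makes it almost
    constant. *)
Lemma parity_of_exchange f L (d : R) : perm_invariant f ->
  avg (fun x => avg (fun y => avg (fun r : L.-tuple V => avg (fun p : L.-tuple V =>
    (f (x :: r) (+) f (y :: r) != f (x :: p) (+) f (y :: p))%:R)))) <= d ->
  exists (chi : pred V) (c : bool),
    avg (fun s : L.+1.-tuple V => (f s != chi_odd chi s (+) c)%:R) <= L.+1%:R * d.
Proof.
move=> f_perm hyp.
have [p hp] : exists p : L.-tuple V, avg (fun x => avg (fun y => avg (fun r : L.-tuple V =>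
    (f (x :: r) (+) f (y :: r) != f (x :: p) (+) f (y :: p))%:R))) <= d.
  apply: avg_le_exists; first exact: card_tuple_gt0.
  apply: le_trans hyp; rewrite avg_exchange; apply: le_avg => x.
  rewrite avg_exchange; apply: le_avg => y; rewrite avg_exchange; exact: le_avg.
pose chi x := f (x :: p); pose q s := f s (+) chi_odd chi s.
have q_perm : perm_invariant q.
  by move=> s t st; rewrite /q (f_perm _ _ st) (chi_odd_perm _ st).
have hq : avg (fun x => avg (fun y => avg (fun s : L.-tuple V =>
    (q (x :: s) != q (y :: s))%:R))) <= d.
  apply: le_trans hp; do 3!apply: le_avg => ?; rewrite ler_nat /q !chi_odd_cons /chi.
  by do 4!case: (f _); case: (chi_odd _ _).
have := replace_all q_perm hq; rewrite avg_exchange => h.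
have [v hv] := avg_le_exists (card_tuple_gt0 _) h.
exists chi, (q v); apply: le_trans hv; apply: le_avg => u; rewrite ler_nat /q.
by case: (f u); case: (f v); case: (chi_odd _ u); case: (chi_odd _ v).
Qed.

(* Both [x r ++ z p] and [x p ++ z r] are orderings of one set, which forces
   [f (x r) + f (y r)] not to depend on [r]. *)
Lemma parity_of_sum g f L (c0 : bool) (d : R) : perm_invariant g -> perm_invariant f ->
  avg (fun s : L.+1.-tuple V => avg (fun t : L.+1.-tuple V =>
    (g (s ++ t) != f s (+) f t (+) c0)%:R)) <= d ->
  exists chi : pred V,
    avg (fun s : L.+1.-tuple V => avg (fun t : L.+1.-tuple V =>
      (g (s ++ t) != chi_odd chi (s ++ t) (+) c0)%:R)) <= (8 * L.+1 + 1)%:R * d.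
Proof.
move=> g_perm f_perm hyp.
pose B (s t : seq V) : R := (g (s ++ t) != f s (+) f t (+) c0)%:R.
have hB : avg (fun x => avg (fun r : L.-tuple V => avg (fun z => avg (fun p : L.-tuple V =>
    B (x :: r) (z :: p))))) <= d.
  apply: le_trans hyp.
  rewrite (avg_tuple_cons _ (fun s => avg (fun t : L.+1.-tuple V => B s t))).
  apply: le_avg => x; apply: le_avg => r.
  by rewrite (avg_tuple_cons _ (fun t => B (x :: r) t)).
have hex : avg (fun x => avg (fun y => avg (fun r : L.-tuple V => avg (fun p : L.-tuple V =>
    (f (x :: r) (+) f (y :: r) != f (x :: p) (+) f (y :: p))%:R)))) <= 4 * d.
  apply: le_trans (_ : avg (fun x => avg (fun y => avg (fun r : L.-tuple V =>
     avg (fun p : L.-tuple V => avg (fun z => B (x :: r) (z :: p) + B (y :: r) (z :: p) +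
       (B (x :: p) (z :: r) + B (y :: p) (z :: r))))))) <= _).
    apply: le_avg => x; apply: le_avg => y; apply: le_avg => r; apply: le_avg => p.
    rewrite -[leLHS](avg_const _ V0); apply: le_avg => z.
    rewrite /B -!natrD ler_nat.
    have E w : g ((w :: r) ++ z :: p) = g ((w :: p) ++ z :: r).
      apply: g_perm; rewrite /= perm_cons -cat_rcons -[_ ++ z :: _]cat_rcons perm_catC.
      by rewrite -!cats1 -!catA perm_cat2l perm_catC.
    rewrite !E; case: (f (x :: r)); case: (f (y :: r)); case: (f (x :: p)); case: (f (y :: p));
      case: (f (z :: p)); case: (f (z :: r)); case: (g ((x :: p) ++ _));
      by case: (g ((y :: p) ++ _)); case: (c0).
  pose K := fun x => avg (fun r : L.-tuple V => avg (fun z => avg (fun p : L.-tuple V =>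
    B (x :: r) (z :: p)))).
  have K1 x : avg (fun r : L.-tuple V => avg (fun p : L.-tuple V => avg (fun z =>
      B (x :: r) (z :: p)))) = K x.
    by apply: eq_avg => r; rewrite avg_exchange.
  have K2 x : avg (fun r : L.-tuple V => avg (fun p : L.-tuple V => avg (fun z =>
      B (x :: p) (z :: r)))) = K x.
    by rewrite avg_exchange K1.
  rewrite (eq_avg (G := fun x => avg (fun y => (K x + K y) + (K x + K y)))); last first.
    move=> x; apply: eq_avg => y.
    under eq_avg => r do under eq_avg => p do rewrite !avgD.
    under eq_avg => r do rewrite !avgD.
    by rewrite !avgD !K1 !K2.
  under eq_avg => x do rewrite !avgD avg_const //.
  rewrite !avgD !avg_const //; move: hB; rewrite -/(avg K); lra.
have [chi [c1 hchi]] := parity_of_exchange f_perm hex.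
exists chi; pose D (s : seq V) : R := (f s != chi_odd chi s (+) c1)%:R.
(* The constant [c1] enters through both [f s] and [f t] and cancels. The error [d] of [B] and the
   two errors [4 * L.+1 * d] of [D] add up to the stated factor. *)
apply: le_trans (_ : avg (fun s : L.+1.-tuple V => avg (fun t : L.+1.-tuple V =>
   B s t + (D s + D t))) <= _).
  apply: le_avg => s; apply: le_avg => t; rewrite /B /D chi_odd_cat -!natrD ler_nat.
  by case: (g _); case: (f s); case: (f t); case: (chi_odd _ s); case: (chi_odd _ t);
    case: c0 {hyp B hB hex}; case: c1 {hchi D}.
under eq_avg => s do rewrite !avgD avg_tuple_const.
rewrite !avgD avg_tuple_const.
have -> : (8 * L.+1 + 1)%:R * d = d + (L.+1%:R * (4 * d) + L.+1%:R * (4 * d)).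
  by rewrite natrD natrM; ring.
by rewrite lerD // lerD.
Qed.

End Replacement.

(** * Exchanges of one entry that change a set function of density near one half *)

Section Exchange.
Variables (R : realFieldType) (V : finType).
Hypothesis V0 : (0 < #|V|)%N.

Lemma avg_mul (T U : finType) (F : T -> R) (G : U -> R) :
  avg (fun x => avg (fun y => F x * G y)) = avg F * avg G.
Proof. by under eq_avg => x do rewrite avgZ; rewrite avgZr. Qed.

Lemma avg_negb (T : finType) (f : pred T) : (0 < #|T|)%N ->
  avg (fun x => (~~ f x)%:R) = 1 - avg (fun x => (f x)%:R) :> R.
Proof.
move=> T0; apply/eqP; rewrite eq_sym subr_eq -avgD; apply/eqP.
by rewrite -[LHS](avg_const 1 T0); apply: eq_avg => x; case: (f x); rewrite ?add0r ?addr0.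
Qed.

Lemma avg_neq (T : finType) (f : pred T) : (0 < #|T|)%N ->
  avg (fun x => avg (fun y => (f x != f y)%:R)) =
  2 * (avg (fun x => (f x)%:R) * (1 - avg (fun x => (f x)%:R))) :> R.
Proof.
move=> T0; rewrite -avg_negb //.
transitivity (avg (fun x => avg (fun y => (f x)%:R * (~~ f y)%:R + (~~ f x)%:R * (f y)%:R)) : R).
  apply: eq_avg => x; apply: eq_avg => y.
  by case: (f x); case: (f y); rewrite ?mulr0 ?mulr1 ?addr0 ?add0r.
under eq_avg => x do rewrite avgD.
by rewrite avgD !avg_mul; ring.
Qed.

Lemma avg_le1 (T : finType) (f : pred T) : (0 < #|T|)%N -> avg (fun x => (f x)%:R) <= 1 :> R.
Proof. by move=> T0; rewrite -[leRHS](avg_const 1 T0); apply: le_avg => x; case: (f x). Qed.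

(* If swapping heads almost never changes [f s + f t], then fixing [p] gives
   [f (x r) - f (y r) = chi x - chi y].  When [chi] takes both values often, this
   forces [f (x r) = chi x], so [f] reads off any coordinate and [chi] is almost
   constant after all; when it does not, [f] is almost constant. *)
Lemma exchange_gap (f : seq V -> bool) L : perm_invariant f ->
  1 / 4 <= (avg (fun s : L.+2.-tuple V => (f s)%:R) : R) <= 3 / 4 ->
  1 / (256 * L.+2%:R ^+ 2) <
  avg (fun x => avg (fun y => avg (fun r : L.+1.-tuple V => avg (fun p : L.+1.-tuple V =>
    (f (x :: r) + f (y :: p) != f (y :: r) + f (x :: p))%N%:R)))) :> R.
Proof.
move=> f_perm; set P := avg _ => /andP[P1 P2].
rewrite ltNge; apply/negP; set d := _ / _ => hyp.
have mR : 2 <= L.+2%:R :> R by rewrite ler_nat.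
have [p hp] : exists p : L.+1.-tuple V, avg (fun x => avg (fun y =>
    avg (fun r : L.+1.-tuple V =>
    (f (x :: r) + f (y :: p) != f (y :: r) + f (x :: p))%N%:R))) <= d.
  apply: avg_le_exists; first exact: card_tuple_gt0.
  apply: le_trans hyp; rewrite avg_exchange; apply: le_avg => x.
  rewrite avg_exchange; apply: le_avg => y; rewrite avg_exchange; exact: le_avg.
pose chi x := f (x :: p); pose al : R := avg (fun x => (chi x)%:R).
(* With $d=\nu^2/4$, both [a1] and [b1] will be at most $\nu/4$, against $a_1+b_1\ge\nu$. The factor
   8 makes $(L+2)\nu=1/8$ for the other case. *)
pose nu : R := 1 / (8 * L.+2%:R).
have al0 : 0 <= al by apply: avg_ge0 => x; rewrite ler0n.
have al1 : al <= 1 by apply: avg_le1.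
have nu0 : 0 < nu by rewrite divr_gt0 // mulr_gt0 //; lra.
have dnu : d = nu ^+ 2 / 4.
  rewrite /d /nu; move: (L.+2%:R : R) mR => z z2.
  by field; rewrite gt_eqF //; lra.
have chi_neq : avg (fun x => avg (fun y => (chi x != chi y)%:R)) = 2 * (al * (1 - al)) :> R.
  exact: avg_neq.
have [big|small] := leP nu (al * (1 - al)).
  pose a1 : R := avg (fun x => avg (fun r : L.+1.-tuple V => (chi x && ~~ f (x :: r))%:R)).
  pose b1 : R := avg (fun x => avg (fun r : L.+1.-tuple V => (~~ chi x && f (x :: r))%:R)).
  have ha : a1 * (1 - al) <= d.
    apply: le_trans hp; rewrite -avg_negb // -avg_mul; apply: le_avg => x; apply: le_avg => y.
    rewrite -avgZr; apply: le_avg => r; rewrite -natrM ler_nat /chi.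
    by do 4!case: (f _).
  have hb : al * b1 <= d.
    apply: le_trans hp; rewrite -avg_mul; apply: le_avg => x; apply: le_avg => y.
    rewrite -avgZ; apply: le_avg => r; rewrite -natrM ler_nat /chi.
    by do 4!case: (f _).
  have chi_small : 2 * (al * (1 - al)) <= 2 * (a1 + b1).
    rewrite -chi_neq; pose M (x : V) (s : seq V) : R := (f s != chi x)%:R.
    have hM : a1 + b1 = avg (fun x => avg (fun r : L.+1.-tuple V => M x (x :: r))).
      rewrite /a1 /b1 -avgD; apply: eq_avg => x; rewrite -avgD; apply: eq_avg => r.
      by rewrite /M -natrD; case: (f _); case: (chi _).
    have hM' : a1 + b1 = avg (fun x => avg (fun y => avg (fun r : L.-tuple V => M x (x :: y :: r)))).
      by rewrite hM; apply: eq_avg => x; rewrite (avg_tuple_cons _ (fun s => M x (x :: s))).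
    apply: le_trans (_ : avg (fun x => avg (fun y => avg (fun r : L.-tuple V =>
       M x (x :: y :: r) + M y (y :: x :: r)))) <= _).
      apply: le_avg => x; apply: le_avg => y; rewrite -[leLHS](avg_tuple_const V0 L).
      apply: le_avg => r; rewrite /M -natrD ler_nat.
      rewrite (f_perm (y :: x :: r) (x :: y :: r)); first by case: (f _); do 2!case: (chi _).
      by apply/permPl; apply: (perm_catCA [:: y] [:: x] r).
    under eq_avg => x do under eq_avg => y do rewrite avgD.
    under eq_avg => x do rewrite avgD.
    rewrite avgD -hM' [X in _ + X]avg_exchange -hM'; lra.
  have a10 : 0 <= a1 by do 2!(apply: avg_ge0 => ?); rewrite ler0n.
  have b10 : 0 <= b1 by do 2!(apply: avg_ge0 => ?); rewrite ler0n.
  have nu1 : nu <= 1 - al by apply: le_trans big _; rewrite ler_piMl // subr_ge0.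
  have nu2 : nu <= al by apply: le_trans big _; rewrite ler_piMr // gerBl.
  have h1 : a1 * nu <= d by apply: le_trans ha; rewrite ler_wpM2l.
  have h2 : nu * b1 <= d by apply: le_trans hb; rewrite ler_wpM2r.
  have h3 : nu * nu <= nu * (a1 + b1) by rewrite ler_pM2l //; lra.
  have h4 : 0 < nu * nu by rewrite mulr_gt0.
  move: h1 h2 h3 h4; rewrite dnu expr2 mulrDr [a1 * nu]mulrC; lra.
have hf : avg (fun x => avg (fun y => avg (fun s : L.+1.-tuple V =>
    (f (x :: s) != f (y :: s))%:R))) <= d + 2 * nu.
  apply: le_trans (_ : d + 2 * (al * (1 - al)) <= _); last by lra.
  apply: le_trans (lerD hp (lexx _)); rewrite -chi_neq -avgD; apply: le_avg => x.
  rewrite -avgD; apply: le_avg => y; rewrite -[X in _ + X](avg_tuple_const V0 L.+1) -avgD.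
  apply: le_avg => r; rewrite -natrD ler_nat /chi; by do 4!case: (f _).
have := replace_all V0 f_perm hf; rewrite avg_neq ?card_tuple_gt0 // -/P.
have mnu : L.+2%:R * nu = 1 / 8.
  rewrite /nu; move: (L.+2%:R : R) mR => z z2.
  by field; rewrite gt_eqF //; lra.
have -> : L.+2%:R * (d + 2 * nu) = (L.+2%:R * nu) * (nu / 4 + 2) by rewrite dnu; field.
rewrite mnu; have : nu <= 1 / 8.
  by rewrite -mnu -[leLHS]mul1r ler_pM2r //; lra.
nra.
Qed.

(** Swapping [x] and [y] turns a drop into a rise, so drops make up exactly half of the changes
    counted by [exchange_gap]. *)
Lemma exchange_drop (f : seq V -> bool) L : perm_invariant f ->
  1 / 4 <= (avg (fun s : L.+2.-tuple V => (f s)%:R) : R) <= 3 / 4 ->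
  1 / (512 * L.+2%:R ^+ 2) <=
  avg (fun x => avg (fun y => avg (fun r : L.+1.-tuple V => avg (fun p : L.+1.-tuple V =>
    (f (y :: r) + f (x :: p) < f (x :: r) + f (y :: p))%N%:R)))) :> R.
Proof.
move=> f_perm /(exchange_gap f_perm); set X := avg _ => gap; set Y := avg _.
have XY : X = Y + Y.
  rewrite {2}/Y avg_exchange /X /Y -avgD; apply: eq_avg => x.
  rewrite -avgD; apply: eq_avg => y; rewrite -avgD; apply: eq_avg => r.
  by rewrite -avgD; apply: eq_avg => p; rewrite -natrD neq_ltn; do 4!case: (f _).
have -> : 1 / (512 * L.+2%:R ^+ 2) = 1 / (256 * L.+2%:R ^+ 2) / 2 :> R.
  have : 0 < L.+2%:R :> R by rewrite ltr0n.
  by move: (L.+2%:R : R) => z z0; field; rewrite gt_eqF.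
by move: gap; rewrite XY; move: (1 / (256 * _)) => z; lra.
Qed.

End Exchange.

(** * From a parity pattern to closeness to a balanced parity hypergraph *)

Section Closeness.
Variables (R : realType) (V : finType).
Hypothesis V0 : (0 < #|V|)%N.

(** The sign $(-1)^{\chi}$ is multiplicative over the entries, and the entries are independent. *)
Lemma avg_sign (chi : pred V) L :
  avg (fun s : L.-tuple V => 1 - 2 * (chi_odd chi s)%:R) =
  (1 - 2 * avg (fun x => (chi x)%:R)) ^+ L :> R.
Proof.
elim: L => [|L IH]; first by rewrite avg_tuple0 /chi_odd /= mulr0 subr0 expr0.
rewrite (avg_tuple_cons _ (fun s => 1 - 2 * (chi_odd chi s)%:R)) exprS -IH.
have -> : 1 - 2 * avg (fun x => (chi x)%:R) = avg (fun x => 1 - 2 * (chi x)%:R) :> R.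
  by under [RHS]eq_avg => x do rewrite -mulNr; rewrite avgD avgZ avg_const // mulNr.
rewrite -avg_mul; apply: eq_avg => x; apply: eq_avg => s; rewrite chi_odd_cons.
by case: (chi x); case: (chi_odd chi s) => /=; ring.
Qed.

Lemma avg_has (D : pred V) L :
  avg (fun s : L.-tuple V => (has D s)%:R) <= L%:R * avg (fun x => (D x)%:R) :> R.
Proof.
elim: L => [|L IH]; first by rewrite avg_tuple0 mul0r.
rewrite (avg_tuple_cons _ (fun s => (has D s)%:R)) -natr1 mulrDl mul1r.
apply: le_trans (lerD IH (lexx _)); rewrite addrC.
rewrite -[X in _ <= _ + X](avg_const _ V0) -avgD; apply: le_avg => x.
rewrite -[X in _ <= X + _](avg_tuple_const V0 L) -avgD; apply: le_avg => s /=.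
by rewrite -natrD ler_nat; case: (D x); case: (has D s).
Qed.

Lemma half_bounds n : (2 * n./2 <= n)%N /\ (n <= 2 * n./2 + 1)%N.
Proof. lia. Qed.

Lemma subset_of_card (A : {set V}) j : (j <= #|A|)%N -> exists2 B : {set V}, B \subset A & #|B| = j.
Proof.
rewrite -bin_gt0 -cards_draws => /card_gt0P[B]; rewrite inE => /andP[BA /eqP Bj].
by exists B.
Qed.

(** The two truncated subtractions add up to the distance between [#|A|] and [#|V|./2]; a balanced
    set is reached by only removing or only adding vertices. *)
Lemma nearest_balanced (A : {set V}) : exists2 B : {set V}, balanced B &
  (#|[set x | (x \in A) != (x \in B)]| <= (#|A| - #|V|./2) + (#|V|./2 - #|A|))%N.
Proof.
have bal (B : {set V}) : #|B| = #|V|./2 -> balanced B.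
  by move=> Bn; have := cardsC B; rewrite Bn; split; lia.
have [le|lt] := leqP #|V|./2 #|A|.
  have [B BA Bn] := subset_of_card le; exists B; first exact: bal.
  rewrite (_ : [set x | _] = A :\: B) ?cardsD ?(setIidPr BA) ?Bn ?leq_addr //.
  apply/setP => x; rewrite !inE; have := subsetP BA x.
  by case: (x \in A); case: (x \in B) => //= /(_ isT).
have le : (#|V| - #|V|./2 <= #|~: A|)%N by have := cardsC A; lia.
have [B BA Bn] := subset_of_card le; exists (~: B).
  by apply: bal; have := cardsC B; lia.
rewrite (_ : [set x | _] = ~: A :\: B) ?cardsD ?(setIidPr BA) ?Bn.
  by have := cardsC A; lia.
apply/setP => x; rewrite !inE; have := subsetP BA x; rewrite inE.
by case: (x \in A); case: (x \in B) => //= /(_ isT).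
Qed.

Variables (k m : nat) (H : kgraph k V).
Hypotheses (m0 : (0 < m)%N) (km : k = (m + m)%N).

(** A sequence of length [k] with a repetition has fewer than [k] distinct entries, so it never
    counts as an edge. *)
Definition edge_seq (s : seq V) := [set x in s] \in edges H.

Lemma edge_seq_perm : perm_invariant edge_seq.
Proof.
move=> s t st; rewrite /edge_seq (_ : [set x in s] = [set x in t]) //.
by apply/setP => x; rewrite !inE (perm_mem st).
Qed.

Definition parity_kgraph (c : bool) (A : {set V}) : kgraph k V :=
  if c then even_kgraph k A else odd_kgraph k A.

Lemma in_parity_kgraph c A (e : {set V}) :
  (e \in edges (parity_kgraph c A)) = (#|e| == k) && (odd #|e :&: A| (+) c).
Proof. by case: c; rewrite /= inE ?addbT ?addbF. Qed.

(** Any enumeration of a set on which the two hypergraphs differ is a [k]-tuple where the predicates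
    disagree, and distinct sets have distinct enumerations. *)
Lemma card_edge_difference c (A : {set V}) :
  #|(edges H :\: edges (parity_kgraph c A)) :|: (edges (parity_kgraph c A) :\: edges H)|%:R
    <= avg (fun s : k.-tuple V => (edge_seq s != chi_odd (mem A) s (+) c)%:R)
       * #|V|%:R ^+ k :> R.
Proof.
rewrite avg_pred card_tuple natrX divfK ?expf_neq0 ?pnatr_eq0 -?lt0n // ler_nat.
set D := [set s | _]; apply: leq_trans (leq_imset_card (fun s : k.-tuple V => [set x in s]) D).
apply/subset_leq_card/subsetP => e eD.
have ek : size (enum e) == k.
  rewrite -cardE; move: eD; rewrite !in_setU !in_setD => /orP[/andP[_ /edges_card->//]|].
  by case/andP => _; rewrite in_parity_kgraph => /andP[].
have e_enum : [set x in enum e] = e by apply/setP => x; rewrite inE mem_enum.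
apply/imsetP; exists (Tuple ek); rewrite ?inE /= ?e_enum // /edge_seq e_enum.
have -> : chi_odd (mem A) (enum e) = odd #|e :&: A|.
  have U : uniq [seq x <- enum e | mem A x] by apply/filter_uniq/enum_uniq.
  rewrite /chi_odd -size_filter -(card_uniqP U); congr (odd _); apply: eq_card => x.
  by rewrite mem_filter mem_enum !inE andbC.
move: eD; rewrite !in_setU !in_setD !in_parity_kgraph [in #|e|]cardE ek /=.
by case: (e \in _); case: (_ (+) _).
Qed.

(** The average sign of [chi_odd] is a power of $1-2\alpha$, where $\alpha$ is the density of [chi].
    Edge density near $1/2$ makes it small, so [chi] is nearly balanced, and relabelling few
    vertices makes it balanced. The term $1/|V|$ pays for an odd number of vertices. *)
Lemma parity_close (chi : pred V) (c : bool) (d kappa beta eps : R) :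
  avg (fun s : m.-tuple V => avg (fun t : m.-tuple V =>
    (edge_seq (s ++ t) != chi_odd chi (s ++ t) (+) c)%:R)) <= d ->
  `|avg (fun s : m.-tuple V => avg (fun t : m.-tuple V => (edge_seq (s ++ t))%:R)) - 1 / 2|
    <= kappa ->
  0 < beta -> 2 * (kappa + d) <= beta ^+ k ->
  d + k%:R * (beta / 2 + 1 / #|V|%:R) <= eps ->
  exists2 A : {set V}, balanced A & eps_close eps H (parity_kgraph c A).
Proof.
move=> hchi hg beta0 hbeta heps.
have n0 : 0 < #|V|%:R :> R by rewrite ltr0n.
have hchi' : avg (fun s : k.-tuple V => (edge_seq s != chi_odd chi s (+) c)%:R) <= d.
  by rewrite km (avg_tuple_cat m m (fun s => (edge_seq s != chi_odd chi s (+) c)%:R)).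
have {hg} hg : `|avg (fun s : k.-tuple V => (edge_seq s)%:R) - 1 / 2| <= kappa.
  by rewrite km (avg_tuple_cat m m (fun s => (edge_seq s)%:R)).
pose al : R := avg (fun x => (chi x)%:R).
have hal : `|1 - 2 * al| <= beta.
  rewrite leNgt; apply/negP => lt.
  have : beta ^+ k < (1 - 2 * al) ^+ k.
    have -> : (1 - 2 * al) ^+ k = `|1 - 2 * al| ^+ k.
      by rewrite km addnn -mul2n !exprM real_normK // num_real.
    by rewrite ltr_pXn2r ?nnegrE ?normr_ge0 ?(ltW beta0) // km addn_gt0 m0.
  rewrite -avg_sign.
  (* Up to the sign determined by [c] and an error [2 * d], the average sign is one minus twice the
     edge density. *)
  have : avg (fun s : k.-tuple V => 1 - 2 * (chi_odd chi s)%:R) <= 2 * (kappa + d).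
    case: c hchi hchi' => _ hchi'.
      apply: le_trans (_ : avg (fun s : k.-tuple V => 2 * (edge_seq s)%:R +
        (2 * (edge_seq s != chi_odd chi s (+) true)%:R + - 1)) <= _).
        apply: le_avg => s; case: (edge_seq s); case: (chi_odd chi s) => /=; lra.
      rewrite !avgD !avgZ (avg_tuple_const V0); move: hg; rewrite ler_norml; lra.
    apply: le_trans (_ : avg (fun s : k.-tuple V => (- 2) * (edge_seq s)%:R +
      (2 * (edge_seq s != chi_odd chi s (+) false)%:R + 1)) <= _).
      apply: le_avg => s; case: (edge_seq s); case: (chi_odd chi s) => /=; lra.
    rewrite !avgD !avgZ (avg_tuple_const V0); move: hg; rewrite ler_norml; lra.
  by move: hbeta; lra.
pose A := [set x | chi x].
have [B balB AB] := nearest_balanced A; exists B => //.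
pose D := [pred x | (x \in A) != (x \in B)].
have hD : avg (fun x => (D x)%:R) <= beta / 2 + 1 / #|V|%:R :> R.
  rewrite avg_pred ler_pdivrMr // mulrDl mul1r mulVf ?gt_eqF //.
  have alA : al * #|V|%:R = #|A|%:R by rewrite /al avg_pred divfK // gt_eqF.
  apply: le_trans (_ : ((#|A| - #|V|./2) + (#|V|./2 - #|A|))%:R <= _).
    by rewrite ler_nat.
  have [] := half_bounds #|V|; rewrite -!(ler_nat R) natrD natrM => hn1 hn2.
  move: hal; rewrite ler_norml => /andP[l1 l2].
  have l1' := ler_wpM2r (ltW n0) l1; have l2' := ler_wpM2r (ltW n0) l2.
  move: l1' l2'; rewrite mulrBl mul1r -mulrA alA => l1' l2'.
  have [le|lt] := leqP #|V|./2 #|A|.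
    have /eqP-> : (#|V|./2 - #|A| == 0)%N by rewrite subn_eq0.
    rewrite addn0 natrB //; lra.
  have /eqP-> : (#|A| - #|V|./2 == 0)%N by rewrite subn_eq0 ltnW.
  rewrite add0n natrB ?(ltnW lt) //; lra.
exists (parity_kgraph c B).
  exists id; first by exists id.
  by apply/setP => e; apply/idP/imsetP => [eE|[e' eE ->]]; [exists e; rewrite ?imset_id|rewrite imset_id].
apply: le_trans (card_edge_difference c B) _.
rewrite ler_wpM2r ?exprn_ge0 ?ler0n //; apply: le_trans heps.
apply: le_trans (_ : avg (fun s : k.-tuple V => (edge_seq s != chi_odd chi s (+) c)%:R +
  (has D s)%:R) <= _).
  apply: le_avg => s; rewrite -natrD ler_nat.
  have [_|nD] := boolP (has D s); first by rewrite addn1; case: (_ != _).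
  have -> : chi_odd (mem B) s = chi_odd chi s.
    rewrite /chi_odd; congr odd; apply: eq_in_count => x xs /=.
    by have := hasPn nD x xs; rewrite /= negbK !inE => /eqP.
  by rewrite addn0.
rewrite avgD lerD //; apply: le_trans (avg_has D k) _.
by rewrite ler_wpM2l ?ler0n.
Qed.

End Closeness.

(** * From block orders to Hamilton cycles *)

Local Open Scope nat_scope.

Lemma cycle_nthP (T : Type) (x0 : T) (r : rel T) (s : seq T) :
  reflect (forall i, i < size s -> r (nth x0 s i) (nth x0 s (i.+1 %% size s))) (cycle r s).
Proof.
case: s => [|x s]; first by constructor.
have E i : i <= size s -> nth x0 (x :: rcons s x) i = nth x0 (x :: s) i /\
    nth x0 (rcons s x) i = nth x0 (x :: s) (i.+1 %% (size s).+1).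
  move=> i_s; rewrite -rcons_cons !nth_rcons /= ltnS i_s; split=> //.
  move: i_s; rewrite leq_eqVlt => /orP[/eqP->|i_s]; first by rewrite ltnn eqxx modnn.
  by rewrite i_s modn_small.
apply: (iffP (pathP x0)) => H i; rewrite ?size_rcons ltnS => i_s;
  have [E1 E2] := E i i_s.
  by have := H i; rewrite size_rcons ltnS i_s E1 E2; apply.
by rewrite E1 E2; apply: H.
Qed.

Section BlockCycle.
Variables (V : finType) (k m t : nat) (H : kgraph k V) (b : 'I_t -> m.-tuple V).
Hypotheses (m0 : 0 < m) (t3 : 2 < t) (km : k = m + m) (cV : #|V| = t * m).
Hypothesis b_blocks : blocks b.

Lemma block_uniq i : uniq (b i).
Proof.
set x0 := tnth (b i) (Ordinal m0).
apply/(uniqP x0) => j l; rewrite !inE size_tuple => jm lm jl.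
have E : tnth (b i) (Ordinal jm) = tnth (b i) (Ordinal lm) by rewrite !(tnth_nth x0).
by have [->] := b_blocks (x1 := (i, Ordinal jm)) (x2 := (i, Ordinal lm)) E.
Qed.

Lemma block_disjoint i j x : x \in b i -> x \in b j -> i = j.
Proof.
move=> /tnthP[l xl] /tnthP[l' xl'].
by have [] := b_blocks (x1 := (i, l)) (x2 := (j, l')) (etrans (esym xl) xl').
Qed.

Lemma block_cover x : exists i, x \in b i.
Proof.
have cc : #|V| <= #|{: 'I_t * 'I_m}| by rewrite card_prod !card_ord cV.
have /codomP[[i l] ->] := inj_card_onto b_blocks cc x.
by exists i; apply: mem_tnth.
Qed.

Variable c : seq 'I_t.
Hypotheses (uc : uniq c) (sc : size c = t).
Hypothesis cc : cycle (fun i j => edge_seq H (b i ++ b j)) c.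

Let i0 : 'I_t := Ordinal (ltn_trans (ltn0Sn 1) t3).
Let s := flatten [seq tval (b i) | i <- c].
(** The index is reduced modulo [t], so that the successor of the last block is the first one. *)
Let B j := [set x in b (nth i0 c (j %% t))].

Lemma mem_order i : i \in c.
Proof.
apply: contraT => ic; have := max_card (mem (i :: c)).
by rewrite (card_uniqP _) /= ?ic // sc card_ord ltnn.
Qed.

Lemma flatten_blocks_rot j (l : seq 'I_t) :
  rot (j * m) (flatten [seq tval (b i) | i <- l]) =
  flatten [seq tval (b i) | i <- rot j l].
Proof.
rewrite /rot; have E q : drop (q * m) (flatten [seq tval (b i) | i <- l]) =
     flatten [seq tval (b i) | i <- drop q l] /\
   take (q * m) (flatten [seq tval (b i) | i <- l]) =
     flatten [seq tval (b i) | i <- take q l].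
  elim: q l => [|q IH] [|i l] //=; rewrite ?mul0n ?drop0 ?take0 //.
  rewrite mulSn drop_cat take_cat !size_tuple ltnNge leq_addr /= addKn.
  by have [-> ->] := IH l.
by have [-> ->] := E j; rewrite map_cat flatten_cat.
Qed.

Lemma window_blocks j : j < t -> window k s (j * m) = B j :|: B j.+1.
Proof.
move=> jt; rewrite /window flatten_blocks_rot /B.
have jc : j < size c by rewrite sc.
have szr : size (rot j c) = t by rewrite size_rot.
have n0 : nth i0 (rot j c) 0 = nth i0 c (j %% t).
  by rewrite /rot nth_cat size_drop subn_gt0 jc nth_drop addn0 modn_small.
have n1 : nth i0 (rot j c) 1 = nth i0 c (j.+1 %% t).
  rewrite /rot nth_cat size_drop nth_drop sc ltn_subRL addn1.
  case: ltnP => [jt'|tj]; first by rewrite modn_small.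
  have -> : j.+1 = t by lia.
  by rewrite modnn nth_take; [congr nth; lia|lia].
have szr1 : 1 < size (rot j c) by rewrite szr ltnW.
move: szr1 n0 n1; case: (rot j c) => [|x [|y r]] //= _ <- <-.
rewrite catA take_size_cat; last by rewrite size_cat !size_tuple km.
by apply/setP => z; rewrite !inE mem_cat.
Qed.

Lemma blocks_hamilton_cycle : contains_hamilton_cycle m H.
Proof.
have t0 : 0 < t by apply: ltn_trans t3.
have Binj j l x : x \in B j -> x \in B l -> j = l %[mod t].
  rewrite !inE => xj xl; have /eqP := block_disjoint xj xl.
  by rewrite nth_uniq ?sc ?ltn_pmod // => /eqP.
have BS j : B (j %% t).+1 = B j.+1.
  by rewrite /B -[(j %% t).+1]addn1 modnDml addn1.
have mod_neq j l : 0 < l < t -> j %% t <> (j + l) %% t.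
  move=> /andP[l0 lt] /eqP; rewrite -[j in j %% t]addn0 eqn_modDl.
  by rewrite mod0n modn_small // eq_sym; case: l l0 {lt}.
have wE j : window k s (j %% t * m) = B j :|: B j.+1.
  by rewrite window_blocks ?ltn_pmod // BS /B modn_mod.
have wH j : window k s (j %% t * m) \in edges H.
  rewrite wE; have := cycle_nthP i0 _ _ cc (j %% t); rewrite sc ltn_pmod //.
  move=> /(_ isT); rewrite /edge_seq; set e1 := [set _ in _]; suff -> : e1 = B j :|: B j.+1 by [].
  by rewrite -BS; apply/setP => x; rewrite !inE mem_cat.
pose p := [seq j * m | j <- iota 0 t].
pose E := [set e in [seq window k s i | i <- p]].
have memE e : e \in E -> exists2 j, j < t & e = window k s (j * m).
  rewrite inE -map_comp => /mapP[j]; rewrite mem_iota => jt ->.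
  by exists j.
have EH e : e \in E -> e \in edges H.
  by move=> /memE[j jt ->]; rewrite -(modn_small jt).
exists (KGraph (fun e eE => edges_card (EH e eE))); first by apply/subsetP.
exists s, p; split.
- have xs x : x \in s.
    have [i xi] := block_cover x; apply/flattenP.
    by exists (tval (b i)) => //; apply/mapP; exists i => //; apply: mem_order.
  split=> //; apply: (@leq_size_uniq _ (enum V)) => //; first exact: enum_uniq.
  rewrite -cardE cV /s size_flatten /shape -map_comp.
  rewrite (eq_map (g := fun=> m)) => [|i]; last by rewrite /= size_tuple.
  by rewrite sumnE big_map big_const_seq count_predT sc iter_addn_0 mulnC.
- split.
    rewrite sorted_map; apply: sub_sorted (iota_ltn_sorted 0 t) => i j /=.
    by rewrite ltn_pmul2r.
  by move=> i /mapP[j]; rewrite mem_iota => jt ->; rewrite cV ltn_pmul2r.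
- move=> e /=; rewrite inE; split=> [/mapP[i ip ->]|[i ip ->]]; first by exists i.
  exact: map_f.
- rewrite cycle_map; apply/(cycle_nthP 0) => j; rewrite size_iota => jt.
  rewrite !nth_iota ?ltn_pmod // !add0n /= -{1}(modn_small jt) !wE.
  (* Here [2 < t] matters: [j] and [j.+2] must differ modulo [t] for the overlap to be a single
     block. *)
  have -> : (B j :|: B j.+1) :&: (B j.+1 :|: B j.+2) = B j.+1.
    apply/setP => x; rewrite !in_setI !in_setU.
    have [//|x1] := boolP (x \in B j.+1); rewrite ?orbT //= orbF.
    apply/negP => /andP[xj xj2]; have := Binj _ _ _ xj xj2.
    by rewrite -addn2; apply: mod_neq; rewrite t3.
  rewrite cardsE (card_uniqP (block_uniq _)); by rewrite size_tuple.
- apply/setP => x; rewrite inE; apply/bigcupP.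
  have [i xi] := block_cover x; have ic := mem_order i.
  have jt : index i c < t by apply: leq_trans (eq_leq sc); rewrite index_mem.
  exists (window k s (index i c * m)).
    by rewrite inE; apply: map_f; apply: map_f; rewrite mem_iota.
  by rewrite window_blocks // !inE modn_small // nth_index // xi.
Qed.

End BlockCycle.

Local Open Scope ring_scope.

(** * Degrees and sampling *)

Lemma min_degree_le k (V : finType) (H : kgraph k V) d (S : {set V}) :
  #|S| = d -> (min_degree d H <= degree H S)%N.
Proof.
move=> /eqP Sd; rewrite /min_degree; elim: (index_enum _) (mem_index_enum S) => // A s IH.
rewrite big_cons inE => /orP[/eqP<-|/IH le]; first by rewrite Sd geq_minl.
by case: ifP => // _; rewrite geq_min le orbT.
Qed.

Section Degrees.
Variables (R : realType) (V : finType) (k m : nat) (H : kgraph k V).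
Hypothesis V0 : (0 < #|V|)%N.

Lemma edge_seq_uniq s : size s = k -> edge_seq H s -> uniq s.
Proof.
move=> sk /edges_card; rewrite cardsE => ck.
by apply/card_uniqP; rewrite ck sk.
Qed.

(** Each edge containing [D] contributes one tuple for every ordering of its other [k - d]
    vertices. *)
Lemma card_extensions d (D : d.-tuple V) : uniq D -> (d <= k)%N ->
  (degree H [set x in D] * (k - d)`! <=
    #|[set w : (k - d).-tuple V | edge_seq H (D ++ w)]|)%N.
Proof.
move=> uD dk; pose W := [set w : (k - d).-tuple V | edge_seq H (D ++ w)]; rewrite -/W.
pose ED := [set e in edges H | [set x in D] \subset e].
pose h (w : (k - d).-tuple V) := [set x in D ++ w].
have hW w : w \in W -> h w \in ED.
  rewrite inE /edge_seq => wH; rewrite inE wH /=.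
  by apply/subsetP => x; rewrite !inE mem_cat => ->.
rewrite /degree -/ED -[leqRHS]sum1_card (partition_big h (mem ED)) //=.
rewrite -sum_nat_const; apply: leq_sum => e eED; rewrite sum1_card.
have [eH De] : e \in edges H /\ [set x in D] \subset e by move: eED; rewrite inE => /andP[].
have ce : #|e :\: [set x in D]| = (k - d)%N.
  by rewrite cardsD (setIidPr De) (edges_card eH) cardsE (card_uniqP uD) size_tuple.
have -> : (k - d)`! = (#|e :\: [set x in D]| ^_ (k - d))%N by rewrite ce ffactnn.
rewrite -card_uniq_tuples.
apply/subset_leq_card/subsetP => w; rewrite !inE => /andP[/allP we uw].
have he : h w = e.
  have we' : [set x in w] = e :\: [set x in D].
    apply/eqP; rewrite eqEcard ce cardsE (card_uniqP uw) size_tuple leqnn andbT.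
    by apply/subsetP => x; rewrite inE => /we.
  apply/setP => x; rewrite inE mem_cat; have := congr1 (fun A : {set V} => x \in A) we'; rewrite !inE => ->.
  have := subsetP De x; rewrite inE; case: (x \in D) => //=; by move=> /(_ isT) ->.
by rewrite unfold_in /= inE /edge_seq -/(h w) he eH eqxx.
Qed.

Lemma avg_extensions (c : R) d (D : d.-tuple V) : uniq D -> (d <= k)%N -> 0 <= c ->
  c * 'C(#|V| - d, k - d)%:R <= (degree H [set x in D])%:R ->
  c * ((#|V| - k)%:R / #|V|%:R) ^+ (k - d) <=
    avg (fun w : (k - d).-tuple V => (edge_seq H (D ++ w))%:R).
Proof.
move=> uD dk c0 cdeg; rewrite avg_pred card_tuple natrX expr_div_n mulrA.
have n0 : 0 < #|V|%:R ^+ (k - d) :> R by rewrite exprn_gt0 // ltr0n.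
rewrite ler_pM2r ?invr_gt0 //.
apply: le_trans (_ : c * 'C(#|V| - d, k - d)%:R * (k - d)`!%:R <= _).
  rewrite -mulrA -natrM bin_ffact ler_wpM2l // -natrX ler_nat.
  by apply: leq_trans (leq_exp_ffact _ _); rewrite -subnDA subnKC.
apply: le_trans (ler_wpM2r (ler0n _ _) cdeg) _.
by rewrite -natrM ler_nat card_extensions.
Qed.

Lemma avg_uniq_extension a b (s : a.-tuple V) : uniq s ->
  ((#|V| - (a + b))%:R / #|V|%:R) ^+ b <=
    avg (fun w : b.-tuple V => (uniq (s ++ w))%:R) :> R.
Proof.
move=> us; rewrite avg_pred card_tuple natrX expr_div_n.
have n0 : 0 < #|V|%:R ^+ b :> R by rewrite exprn_gt0 // ltr0n.
rewrite ler_pM2r ?invr_gt0 // -natrX ler_nat subnDA.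
apply: leq_trans (leq_exp_ffact _ _) _.
have -> : (#|V| - a)%N = #|~: [set x in s]|.
  by rewrite -(cardsC [set x in s]) cardsE (card_uniqP us) size_tuple addKn.
rewrite -card_uniq_tuples; apply/subset_leq_card/subsetP => w.
rewrite !inE cat_uniq us => /andP[/allP ws ->]; rewrite andbT /=.
apply/hasPn => x xw; have : x \in ~: [set y in s] by apply: ws.
by rewrite !inE.
Qed.

Hypotheses (km : k = (m + m)%N) (kn : (k <= #|V|)%N).

Lemma ratio_bound j : (j <= m)%N ->
  1 - (m * k)%:R / #|V|%:R <= ((#|V| - k)%:R / #|V|%:R) ^+ j :> R.
Proof.
move=> jm; have n0 : 0 < #|V|%:R :> R by rewrite ltr0n.
have -> : (#|V| - k)%:R / #|V|%:R = 1 - k%:R / #|V|%:R :> R.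
  by rewrite natrB // mulrBl divff ?gt_eqF.
have kn0 : 0 <= k%:R / #|V|%:R :> R by rewrite divr_ge0 ?ler0n.
have kn1 : k%:R / #|V|%:R <= 1 :> R by rewrite ler_pdivrMr // mul1r ler_nat.
apply: le_trans (bernoulli j (_ : -1 <= - (k%:R / #|V|%:R))); last by lra.
rewrite mulrN lerD2l lerN2 natrM -mulrA ler_wpM2r // ler_nat //.
Qed.

Lemma avg_nonuniq : avg (fun s : m.-tuple V => (~~ uniq s)%:R) <= (m * k)%:R / #|V|%:R :> R.
Proof.
rewrite avg_negb ?card_tuple_gt0 //.
have := @avg_uniq_extension 0 m [tuple] isT.
have -> : avg (fun w : m.-tuple V => (uniq ([tuple] ++ w))%:R) =
  avg (fun w : m.-tuple V => (uniq w)%:R) :> R by [].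
have := ratio_bound (leqnn m); rewrite add0n => h1 h2.
have n0 : 0 < #|V|%:R :> R by rewrite ltr0n.
have : ((#|V| - k)%:R / #|V|%:R) ^+ m <= ((#|V| - m)%:R / #|V|%:R) ^+ m :> R.
  rewrite lerXn2r ?nnegrE ?divr_ge0 ?ler0n // ler_pM2r ?invr_gt0 // ler_nat.
  by rewrite leq_sub2l // km leq_addr.
lra.
Qed.

(** The [m] new entries split into [d - m] that extend [s] to a [d]-set, as almost every choice
    does, and [k - d] that are counted by the degree of that set. *)
Lemma tuple_degree (c : R) d (s : m.-tuple V) : uniq s -> (m <= d <= k)%N -> 0 <= c -> c <= 1 ->
  c * 'C(#|V| - d, k - d)%:R <= (min_degree d H)%:R ->
  c - (m * k)%:R / #|V|%:R <= avg (fun t : m.-tuple V => (edge_seq H (s ++ t))%:R).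
Proof.
move=> us /andP[md dk] c0 c1 hdeg.
have E : ((d - m) + (k - d) = m)%N by lia.
apply: le_trans (_ : c * ((#|V| - k)%:R / #|V|%:R) ^+ m <= _).
  have := ler_wpM2l c0 (ratio_bound (leqnn m)); rewrite mulrBr mulr1.
  have q0 : 0 <= (m * k)%:R / #|V|%:R :> R by rewrite divr_ge0 ?ler0n.
  have := ler_wpM2r q0 c1; rewrite mul1r; lra.
pose c' := c * ((#|V| - k)%:R / #|V|%:R) ^+ (k - d).
have c'0 : 0 <= c' by rewrite mulr_ge0 // exprn_ge0 // divr_ge0 ?ler0n.
have -> : avg (fun t : m.-tuple V => (edge_seq H (s ++ t))%:R) =
  avg (fun t : (d - m).-tuple V => avg (fun w : (k - d).-tuple V =>
    (edge_seq H (s ++ t ++ w))%:R)) :> R.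
  by rewrite -(avg_tuple_cat (d - m) (k - d) (fun t => (edge_seq H (s ++ t))%:R)) E.
apply: le_trans (_ : avg (fun t : (d - m).-tuple V => c' * (uniq (s ++ t))%:R) <= _); last first.
  apply: le_avg => t; have [ust|_] := boolP (uniq (s ++ t)); last first.
    by rewrite mulr0; apply: avg_ge0 => w; rewrite ler0n.
  have szD : size (s ++ t) == d by rewrite size_cat !size_tuple subnKC.
  have := @avg_extensions c d (Tuple szD) ust dk c0; rewrite mulr1 /=.
  under eq_avg => w do rewrite -catA.
  apply; apply: le_trans hdeg _; rewrite ler_nat; apply: min_degree_le.
  by rewrite cardsE (card_uniqP ust) (eqP szD).
rewrite avgZ -[in leLHS]E addnC exprD mulrA -/c' ler_wpM2l //.
apply: le_trans (avg_uniq_extension (d - m) us).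
have n0 : 0 < #|V|%:R :> R by rewrite ltr0n.
rewrite lerXn2r ?nnegrE ?divr_ge0 ?ler0n // ler_pM2r ?invr_gt0 // ler_nat.
by rewrite leq_sub2l // subnKC.
Qed.

End Degrees.

(* Seven is the number of predicates that [exchange_hamiltonian] samples. *)
Definition representative (R : realType) (V : finType) (t m : nat) (eta : R)
    (P : nat -> seq V -> seq V -> seq V -> bool) (b : 'I_t -> m.-tuple V) : Prop :=
  forall i (s s' : m.-tuple V), (i < 7)%N ->
    `|#|[set j | P i s s' (b j)]|%:R - avg (fun x : m.-tuple V => (P i s s' x)%:R) * t%:R|
      <= eta * t%:R.

Lemma sampling_predicates (R : realType) (m : nat) (eta : R) : (0 < m)%N -> 0 < eta ->
  exists n1 : nat, forall (V : finType) (t : nat), (0 < t)%N -> (n1 <= #|V|)%N ->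
    #|V| = (t * m)%N ->
  forall P : nat -> seq V -> seq V -> seq V -> bool,
  exists2 b : 'I_t -> m.-tuple V, blocks b & representative eta P b.
Proof.
move=> m0 eta0; have [n1 n1P] := sampling (m + m + 4) m0 eta0.
exists (maxn n1 2) => V t t0; rewrite geq_max => /andP[nV n2] cV P.
(* The Boolean lists every family with its complement, which makes the bounds two-sided. As $2\cdot
   7\le 2^4\le n^4$, the list fits under the exponent $2m+4$. *)
pose L := (bool * 'I_7 * (m.-tuple V * m.-tuple V))%type.
pose F (l : L) : {set m.-tuple V} :=
  [set x : m.-tuple V | P l.1.2 l.2.1 l.2.2 x == l.1.1].
have cL : (#|{: L}| <= #|V| ^ (m + m + 4))%N.
  rewrite !card_prod card_bool card_ord !card_tuple !expnD mulnC leq_mul2l.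
  apply/orP; right; apply: leq_trans (_ : 2 ^ 4 <= _)%N => //.
  by rewrite leq_exp2r.
have [b b_blocks bP] := n1P V t t0 nV cV _ F cL; exists b => // i s s' i7.
have avgF beta : #|F (beta, Ordinal i7, (s, s'))|%:R / #|V|%:R ^+ m =
    avg (fun x : m.-tuple V => (P i s s' x == beta)%:R) :> R.
  by rewrite avg_pred card_tuple natrX.
have V0 : (0 < #|V|)%N by rewrite ltnW.
have := bP (true, Ordinal i7, (s, s')); rewrite avgF.
have := bP (false, Ordinal i7, (s, s')); rewrite avgF.
have -> : avg (fun x : m.-tuple V => (P i s s' x == true)%:R) =
  avg (fun x : m.-tuple V => (P i s s' x)%:R) :> R.
  by apply: eq_avg => x; rewrite eqb_id.
have -> : avg (fun x : m.-tuple V => (P i s s' x == false)%:R) =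
  1 - avg (fun x : m.-tuple V => (P i s s' x)%:R) :> R.
  rewrite -avg_negb ?card_tuple_gt0 //.
  by apply: eq_avg => x; rewrite eqbF_neg.
have -> : [set j | b j \in F (true, Ordinal i7, (s, s'))] = [set j | P i s s' (b j)].
  by apply/setP => j; rewrite !inE /= eqb_id.
have -> : [set j | b j \in F (false, Ordinal i7, (s, s'))] = ~: [set j | P i s s' (b j)].
  by apply/setP => j; rewrite !inE /= eqbF_neg.
have : #|[set j | P i s s' (b j)]|%:R + #|~: [set j | P i s s' (b j)]|%:R = t%:R :> R.
  by rewrite -natrD cardsC card_ord.
rewrite ler_distl; lra.
Qed.

Lemma markov_ge (R : realFieldType) (T : finType) (F : T -> R) (a : R) :
  (0 < #|T|)%N -> 0 <= a -> (forall x, F x <= 1) -> 2 * a <= avg F ->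
  a <= avg (fun x => (a <= F x)%R%:R).
Proof.
move=> T0 a0 F1 Fa; have : avg F <= a + avg (fun x => (a <= F x)%R%:R).
  rewrite -[X in X + _](avg_const a T0) -avgD; apply: le_avg => x.
  case: (leP a (F x)) => [_|/ltW h]; rewrite ?addr0 //.
  by apply: le_trans (F1 x) _; rewrite lerDr.
lra.
Qed.

Lemma markov_le (R : realFieldType) (T : finType) (F : T -> R) (a : R) :
  0 < a -> (forall x, 0 <= F x) -> avg F <= a * a ->
  avg (fun x => (a < F x)%R%:R) <= a.
Proof.
move=> a0 F0 Fa; rewrite -(ler_pM2l a0) -avgZ; apply: le_trans Fa.
by apply: le_avg => x; case: ltP => [/ltW|_]; rewrite ?mulr1 ?mulr0.
Qed.

(** * Hamilton cycles when any two near-halves span many edges *)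

Section Linked.
Variables (R : realType) (V : finType) (k m t : nat) (H : kgraph k V).
Hypotheses (m0 : (0 < m)%N) (km : k = (m + m)%N) (cV : #|V| = (t * m)%N).
Notation g := (edge_seq H).

Lemma edge_seq_sym s s' : g (s ++ s') = g (s' ++ s).
Proof. by apply: edge_seq_perm; rewrite perm_catC. Qed.

Lemma edge_seq_irr (s : m.-tuple V) : g (s ++ s) = false.
Proof.
apply/negP => /edge_seq_uniq; rewrite size_cat !size_tuple km => /(_ erefl).
rewrite cat_uniq => /and3P[_ /hasPn ns _].
case: (tval s) (size_tuple s) ns => [|x s'] /= sz; first by move: m0; rewrite -sz.
by move=> /(_ x); rewrite !mem_head => /(_ isT).
Qed.

(** Predicates 0 and 1 control degrees and their complements. Predicate 2 finds non-neighbours of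
    [s] with many neighbours among the non-neighbours of [s']; predicate 3, read with such a tuple
    as [s], finds those neighbours among the blocks. *)
Definition linked_predicates (sigma : R) (i : nat) (s s' x : seq V) : bool :=
  match i with
  | 0 => g (s ++ x)
  | 1 => ~~ g (s ++ x)
  | 2 => ~~ g (s ++ x) && (sigma <= avg (fun y : m.-tuple V => (~~ g (s' ++ y) && g (x ++ y))%:R))
  | _ => ~~ g (s' ++ x) && g (s ++ x)
  end.

(** Suppose [A] and [B] span no edge, with [a] in [A] and [c] in [B]. Then [A] fills the
    non-neighbours of [c] up to [10 * eta * t] blocks, and [B] those of [a]. Linking supplies at
    least [(sigma - eta) * t] suitable non-neighbours of [c], so one lies in [A], and then likewise
    one of its neighbours lies in [B]. *)
Lemma linked_hamiltonian (sigma eta : R) (b : 'I_t -> m.-tuple V) :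
  blocks b -> 0 < eta -> 16 * eta <= sigma -> sigma <= 1 / 16 -> 2 < eta * t%:R -> (2 < t)%N ->
  (forall s : m.-tuple V, uniq s ->
     1 / 2 - eta <= avg (fun x : m.-tuple V => (g (s ++ x))%:R)) ->
  (forall s s' : m.-tuple V, uniq s -> uniq s' ->
     1 / 2 - 9 * eta <= avg (fun x : m.-tuple V => (~~ g (s ++ x))%:R) ->
     1 / 2 - 9 * eta <= avg (fun x : m.-tuple V => (~~ g (s' ++ x))%:R) ->
     2 * sigma <= avg (fun x : m.-tuple V => avg (fun y : m.-tuple V =>
       (~~ g (s ++ x) && (~~ g (s' ++ y) && g (x ++ y)))%:R))) ->
  representative eta (linked_predicates sigma) b ->
  hamiltonian (fun i j => g (b i ++ b j)).
Proof.
move=> b_blocks eta0 es s16 et2 t3 deg link rep.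
have V0 : (0 < #|V|)%N by rewrite cV muln_gt0 m0 (ltn_trans _ t3).
have X0 := card_tuple_gt0 V0 m.
have tR : 0 < t%:R :> R by rewrite ltr0n (ltn_trans _ t3).
have sig0 : 0 < sigma by lra.
have b_uniq i : uniq (b i) := block_uniq m0 b_blocks i.
pose z0 := b (Ordinal (ltn_trans (ltn0Sn 1) t3)).
have deg' i : (1 / 2 - 2 * eta) * t%:R <= #|[set j | g (b i ++ b j)]|%:R.
  have := rep 0%N (b i) z0 isT; rewrite ler_distl /= => /andP[h _].
  apply: le_trans h; have := ler_wpM2r (ltW tR) (deg _ (b_uniq i)); lra.
have codeg i : #|[set j | ~~ g (b i ++ b j)]|%:R <= (1 / 2 + 2 * eta) * t%:R.
  have -> : [set j | ~~ g (b i ++ b j)] = ~: [set j | g (b i ++ b j)].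
    by apply/setP => j; rewrite !inE.
  have : #|[set j | g (b i ++ b j)]|%:R + #|~: [set j | g (b i ++ b j)]|%:R = t%:R :> R.
    by rewrite -natrD cardsC card_ord.
  have := deg' i; lra.
have conn0 c : 0 <= c -> 0 <= c * t%:R by move=> c0; rewrite mulr_ge0 // ltW.
(* The condition [l + t <= 3 * d + 1] compares $3/2-7\eta$ with $3/2-6\eta$; the slack $\eta t>2$
   absorbs the rounding of [d]. *)
pose d := Num.truncn ((1 / 2 - 2 * eta) * t%:R).
pose l := Num.truncn ((1 / 2 - 7 * eta) * t%:R).
have d1 : d%:R <= (1 / 2 - 2 * eta) * t%:R by rewrite truncn_le // conn0 //; lra.
have d2 : (1 / 2 - 2 * eta) * t%:R < d%:R + 1 by rewrite natr1; apply: truncnS_gt.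
have l1 : l%:R <= (1 / 2 - 7 * eta) * t%:R by rewrite truncn_le // conn0 //; lra.
have l2 : (1 / 2 - 7 * eta) * t%:R < l%:R + 1 by rewrite natr1; apply: truncnS_gt.
apply: (@linked_halves_hamiltonian _ _ d l).
- by rewrite card_ord.
- by move=> i j; rewrite edge_seq_sym.
- by move=> i; apply: edge_seq_irr.
- by move=> i; rewrite -(ler_nat R); apply: le_trans (deg' i).
- move=> A B lA lB.
  have big (C : {set 'I_t}) : (l <= #|C|)%N -> (1 / 2 - 8 * eta) * t%:R <= #|C|%:R.
    by rewrite -(ler_nat R); move: l2 et2; lra.
  have pos (C : {set 'I_t}) : (l <= #|C|)%N -> exists i, i \in C.
    move=> /big h; apply/card_gt0P; rewrite -(ltr_nat R); apply: lt_le_trans h.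
    by rewrite mulr_gt0 //; lra.
  have [a aA] := pos A lA; have [c cB] := pos B lB.
  have [/existsP[x /existsP[y /and3P[xA yB xy]]]|none] :=
      boolP [exists x, exists y, [&& x \in A, y \in B & g (b x ++ b y)]].
    by exists x, y.
  have nAB x y : x \in A -> y \in B -> ~~ g (b x ++ b y).
    move=> xA yB; apply: contra none => xy.
    by apply/existsP; exists x; apply/existsP; exists y; rewrite xA yB.
  have half i (C : {set 'I_t}) : (l <= #|C|)%N -> (forall j, j \in C -> ~~ g (b i ++ b j)) ->
      1 / 2 - 9 * eta <= avg (fun x : m.-tuple V => (~~ g (b i ++ x))%:R).
    move=> /big lC Ci; have := rep 1%N (b i) z0 isT; rewrite ler_distl /= => /andP[_ h].
    have : #|C|%:R <= #|[set j | ~~ g (b i ++ b j)]|%:R :> R.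
      by rewrite ler_nat; apply/subset_leq_card/subsetP => j /Ci; rewrite inE.
    by move=> CN; rewrite -(ler_pM2r tR); lra.
  have halfa : 1 / 2 - 9 * eta <= avg (fun x : m.-tuple V => (~~ g (b a ++ x))%:R).
    by apply: (half a B lB) => j /(nAB a j aA).
  have halfc : 1 / 2 - 9 * eta <= avg (fun x : m.-tuple V => (~~ g (b c ++ x))%:R).
    by apply: (half c A lA) => j jA; rewrite edge_seq_sym nAB.
  pose F (x : m.-tuple V) := avg (fun y : m.-tuple V => (~~ g (b a ++ y) && g (x ++ y))%:R) : R.
  have hF : sigma <= avg (fun x : m.-tuple V => (~~ g (b c ++ x) && (sigma <= F x)%R)%:R).
    have := link (b c) (b a) (b_uniq c) (b_uniq a) halfc halfa.
    set G := fun x => avg _; have G1 x : G x <= 1 by apply: avg_le1.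
    move=> /(markov_ge X0 (ltW sig0) G1); move/le_trans; apply; apply: le_avg => x.
    rewrite ler_nat /G /F; case: (g (b c ++ x)) => //=.
    by rewrite avg_const // leNgt sig0.
  have many (C : {set 'I_t}) i (Q : pred 'I_t) : (l <= #|C|)%N ->
      (sigma - eta) * t%:R <= #|[set j | Q j]|%:R -> (forall j, Q j -> ~~ g (b i ++ b j)) ->
      (forall j, j \in C -> ~~ g (b i ++ b j)) -> exists j, j \in C /\ Q j.
    move=> /big lC lQ Qi Ci.
    have [/existsP[j /andP[jC Qj]]|no] := boolP [exists j, (j \in C) && Q j]; first by exists j.
    have : (#|[set j | Q j]| + #|C| <= #|[set j | ~~ g (b i ++ b j)]|)%N.
      rewrite -cardsUI [_ :&: _](_ : _ = set0) ?cards0 ?addn0.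
        by apply/subset_leq_card/subsetP => j; rewrite !inE => /orP[/Qi|/Ci].
      apply/setP => j; rewrite !inE; apply: contraNF no => /andP[Qj jC].
      by apply/existsP; exists j; rewrite jC.
    rewrite -(ler_nat R) natrD => h; have := codeg i => h2.
    have : (sigma - eta) * t%:R <= (10 * eta) * t%:R by lra.
    by rewrite ler_pM2r //; lra.
  have [i [iA /andP[nci Fi]]] : exists j, j \in A /\
      (fun j => ~~ g (b c ++ b j) && (sigma <= F (b j))) j.
    apply: (many A c) => //; last by move=> j jA; rewrite edge_seq_sym nAB.
      have := rep 2%N (b c) (b a) isT; rewrite ler_distl /= => /andP[h _].
      by apply: le_trans h; rewrite mulrBl lerD2r ler_wpM2r // ltW.
    by move=> j /andP[].
  have [j [jB /andP[naj gij]]] : exists j, j \in B /\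
      (fun j => ~~ g (b a ++ b j) && g (b i ++ b j)) j.
    apply: (many B a) => //; last by move=> j jB; rewrite nAB.
      have := rep 3%N (b i) (b a) isT; rewrite ler_distl /= => /andP[h _].
      by apply: le_trans h; rewrite mulrBl lerD2r ler_wpM2r // ltW.
    by move=> j /andP[].
  by exists i, j.
- by rewrite -(ler_nat R); apply: le_trans l1 _; move: d2 et2; lra.
- rewrite card_ord -(ler_nat R) (natrD _ l) (natrD _ (3 * d)) (natrM _ 3).
  by move: l1 d2 et2; lra.
Qed.

End Linked.

(** * Sparse pairs of halves *)

Section Dichotomy.
Variables (R : realFieldType) (X : finType) (G : rel X) (U : pred X) (sigma : R).
Hypotheses (X0 : (0 < #|X|)%N) (G_sym : symmetric G) (sigma0 : 0 <= sigma).
Hypothesis G_deg : forall x, U x -> 1 / 2 - sigma <= avg (fun y => (G x y)%:R).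
Hypothesis U_small : avg (fun x => (~~ U x)%:R) <= sigma.
Local Notation "mu( f )" := (avg (fun x => (f x)%:R) : R).
Local Notation avg2 F := (avg (fun x => avg (fun y => (F x y)%:R)) : R).

Lemma almost_complete (f h : pred X) : 1 / 2 - sigma <= mu(h) ->
  avg2 (fun x y => [&& f x, h y & G x y]) <= sigma ->
  avg2 (fun x y => [&& f x, ~~ h y & ~~ G x y]) <= 4 * sigma.
Proof.
move=> mh fhG.
have f1 : mu(f) <= 1 by apply: avg_le1.
have f0 : 0 <= mu(f) by apply: avg_ge0 => x; rewrite ler0n.
have fnh : avg2 (fun x y => f x && ~~ h y) <= mu(f) * (1 / 2 + sigma).
  have -> : avg2 (fun x y => f x && ~~ h y) = mu(f) * (1 - mu(h)).
    rewrite -avg_negb // -avg_mul; apply: eq_avg => x; apply: eq_avg => y.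
    by rewrite -natrM mulnb.
  by rewrite ler_wpM2l //; lra.
have fG : mu(f) * (1 / 2 - sigma) - sigma <= avg2 (fun x y => f x && G x y).
  rewrite lerBlDr; apply: le_trans (lerD (lexx _) U_small).
  rewrite -avgZr -avgD; apply: le_avg => x.
  have -> : avg (fun y => (f x && G x y)%:R) = (f x)%:R * avg (fun y => (G x y)%:R) :> R.
    by rewrite -avgZ; apply: eq_avg => y; rewrite -natrM mulnb.
  have [Ux|_] := boolP (U x); rewrite ?addr0; first by rewrite ler_wpM2l ?ler0n ?G_deg.
  have : 0 <= avg (fun y => (G x y)%:R) :> R by apply: avg_ge0 => y; rewrite ler0n.
  case: (f x) => h0; rewrite ?mul1r ?mul0r ?addr_ge0 ?ler0n //.
  by apply: le_trans (_ : 1 <= _); [move: sigma0; lra|rewrite ler_wpDl].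
have : avg2 (fun x y => [&& f x, ~~ h y & ~~ G x y]) + avg2 (fun x y => f x && G x y) <=
    avg2 (fun x y => f x && ~~ h y) + avg2 (fun x y => [&& f x, h y & G x y]).
  rewrite -!avgD; apply: le_avg => x; rewrite -!avgD; apply: le_avg => y.
  by rewrite -!natrD ler_nat; case: (f x); case: (h y); case: (G x y).
have : mu(f) * sigma <= 1 * sigma by rewrite ler_wpM2r.
lra.
Qed.

(* Rows of [f] are complete to the complement of [h] and empty to [h]; a point of
   both [f] and [h] and a point of exactly one of them would contradict this, so
   [f] and [h] are almost disjoint or almost equal. *)
Lemma half_dichotomy (f h : pred X) (omega : R) :
  1 / 2 - sigma <= mu(f) -> 1 / 2 - sigma <= mu(h) ->
  avg2 (fun x y => [&& f x, h y & G x y]) <= sigma ->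
  0 < omega -> 5 * sigma <= omega * omega ->
  avg2 (fun x y => G x y != f x (+) f y (+) true) <= 14 * sigma + 4 * omega \/
  (avg2 (fun x y => [&& f x, f y & G x y]) <= sigma + omega /\
   avg2 (fun x y => [&& f x, ~~ f y & ~~ G x y]) <= 4 * sigma + omega).
Proof.
move=> mf mh fhG omega0 so.
have hfG : avg2 (fun x y => [&& h x, f y & G x y]) <= sigma.
  apply: le_trans fhG; rewrite avg_exchange; apply: le_avg => x; apply: le_avg => y.
  by rewrite G_sym ler_nat andbCA.
have c1 := almost_complete mh fhG; have c2 := almost_complete mf hfG.
pose lam := mu(fun x => f x && h x).
have lf : lam * mu(fun x => f x && ~~ h x) <= omega * omega.
  apply: le_trans so; have -> : 5 * sigma = 4 * sigma + sigma by ring.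
  apply: le_trans (lerD c1 hfG); rewrite -avg_mul -avgD; apply: le_avg => x.
  rewrite -avgD; apply: le_avg => y; rewrite -natrM -natrD ler_nat /=.
  by case: (f x); case: (f y); case: (h x); case: (h y); case: (G x y).
have lh : lam * mu(fun x => h x && ~~ f x) <= omega * omega.
  apply: le_trans so; have -> : 5 * sigma = 4 * sigma + sigma by ring.
  apply: le_trans (lerD c2 fhG); rewrite -avg_mul -avgD; apply: le_avg => x.
  rewrite -avgD; apply: le_avg => y; rewrite -natrM -natrD ler_nat /=.
  by case: (f x); case: (f y); case: (h x); case: (h y); case: (G x y).
(* Since [lam] times either one-sided difference is at most $\omega^2$, either [lam] or both
   differences are at most $\omega$. *)
have [small|big] := leP lam omega; [left|right].
  have out : mu(fun x => ~~ f x && ~~ h x) <= 2 * sigma + omega.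
    have : mu(f) + mu(h) + mu(fun x => ~~ f x && ~~ h x) <= 1 + lam.
      rewrite -[X in X + lam](avg_const (1%:R) X0) -!avgD; apply: le_avg => x /=.
      by rewrite -!natrD ler_nat; case: (f x); case: (h x).
    lra.
  (* [A] marks the points where [f] and [h] fail to be complementary. The final bound is
     $4\sigma+\sigma$ twice, plus the average of [A] twice. *)
  pose A x := (f x && h x)%:R + (~~ f x && ~~ h x)%:R : R.
  have hA : avg A <= 2 * sigma + 2 * omega by rewrite avgD; move: out small; rewrite /lam /=; lra.
  apply: le_trans (_ : avg (fun x => avg (fun y =>
     [&& f x, h y & G x y]%:R + [&& f x, ~~ h y & ~~ G x y]%:R +
     ([&& h x, f y & G x y]%:R + [&& h x, ~~ f y & ~~ G x y]%:R) + (A x + A y))) <= _).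
    apply: le_avg => x; apply: le_avg => y; rewrite /A -!natrD ler_nat.
    by case: (f x); case: (f y); case: (h x); case: (h y); case: (G x y).
  clearbody A; under eq_avg => x do rewrite !avgD avg_const //.
  rewrite !avgD avg_const //; move: hA c1 c2 fhG hfG; lra.
have lam0 : 0 < lam by apply: lt_trans big.
have bound z : 0 <= z -> lam * z <= omega * omega -> z <= omega.
  move=> z0 lz; rewrite -(ler_pM2l omega0); apply: le_trans lz.
  by rewrite ler_wpM2r // ltW.
have {lf} lf : mu(fun x => f x && ~~ h x) <= omega by apply: bound => //; apply: avg_ge0 => x; rewrite ler0n.
have {lh} lh : mu(fun x => h x && ~~ f x) <= omega by apply: bound => //; apply: avg_ge0 => x; rewrite ler0n.
split.
  apply: le_trans (_ : avg (fun x => avg (fun y =>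
     [&& f x, h y & G x y]%:R + (f y && ~~ h y)%:R)) <= _).
    apply: le_avg => x; apply: le_avg => y; rewrite -natrD ler_nat /=.
    by case: (f x); case: (f y); case: (h y); case: (G x y).
  under eq_avg => x do rewrite avgD.
  by rewrite avgD avg_const // lerD.
apply: le_trans (_ : avg (fun x => avg (fun y =>
   [&& f x, ~~ h y & ~~ G x y]%:R + (h y && ~~ f y)%:R)) <= _).
  apply: le_avg => x; apply: le_avg => y; rewrite -natrD ler_nat /=.
  by case: (f x); case: (f y); case: (h y); case: (G x y).
under eq_avg => x do rewrite avgD.
by rewrite avgD avg_const // lerD.
Qed.
End Dichotomy.

(** After [r] pairs only [2 * r < q] indices are used, so both [J] and the row of the chosen [j]
    still offer a free one. In the application [F i j] is the value of [f] on block [i] with the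
    head of block [j], and each strict drop lowers the sum by at least one. *)
Lemma greedy_pairing (I : finType) (F : I -> I -> nat) (bad : rel I) (J : {set I}) q :
  (q <= #|J|)%N ->
  (forall j, j \in J -> (q <= #|[set i | (F i j + F j i < F i i + F j j) &&
     (~~ bad i j && ~~ bad j i)]|)%N) ->
  forall r, (2 * r <= q)%N -> exists pr : I -> I,
    [/\ involutive pr, #|[set i | pr i != i]| = (2 * r)%N,
        forall i, pr i != i -> ~~ bad i (pr i) &
        (\sum_i F i (pr i) + r <= \sum_i F i i)%N].
Proof.
move=> qJ qF; elim=> [|r IH] rq.
  exists id; split=> //; last by rewrite addn0.
    by rewrite -[RHS](@cards0 I); apply: eq_card => i; rewrite !inE eqxx.
  by move=> i; rewrite eqxx.
have rq' : (2 * r < q)%N by lia.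
have [pr [prK cU prB prF]] := IH (ltnW rq').
set U := [set i | _] in cU.
have pick_out (C : {set I}) : (q <= #|C|)%N -> exists2 x, x \in C & pr x = x.
  move=> qC; have /subsetPn[x xC xU] : ~~ (C \subset U).
    by apply: contraL rq' => /subset_leq_card; rewrite cU -leqNgt; apply: leq_trans.
  by exists x => //; move: xU; rewrite inE negbK => /eqP.
have [j jJ prj] := pick_out J qJ.
have [i] := pick_out _ (qF j jJ); rewrite inE => /and3P[Fij bij bji] pri.
have ij : i != j by apply: contraTneq Fij => ->; rewrite ltnn.
pose pr' x := if x == i then j else if x == j then i else pr x.
have pri' : pr' i = j by rewrite /pr' eqxx.
have prj' : pr' j = i by rewrite /pr' eqxx eq_sym (negPf ij).
have prx x : x != i -> x != j -> pr' x = pr x.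
  by rewrite /pr' => /negPf-> /negPf->.
have prni x : x != i -> pr x != i.
  by apply: contra => /eqP E; rewrite -(prK x) E pri.
have prnj x : x != j -> pr x != j.
  by apply: contra => /eqP E; rewrite -(prK x) E prj.
exists pr'; split.
- move=> x; have [->|xi] := eqVneq x i; first by rewrite pri'.
  have [->|xj] := eqVneq x j; first by rewrite prj'.
  by rewrite (prx x) // prx ?prni ?prnj.
- have -> : [set x | pr' x != x] = i |: (j |: U).
    apply/setP => x; rewrite !inE.
    have [->|xi] := eqVneq x i; first by rewrite pri' eq_sym ij.
    by have [->|xj] := eqVneq x j; [rewrite prj' ij|rewrite prx].
  rewrite !cardsU1 !inE (negPf ij) pri prj !eqxx cU /=; lia.
- move=> x; have [->|xi] := eqVneq x i; first by rewrite pri'.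
  have [->|xj] := eqVneq x j; first by rewrite prj'.
  by rewrite prx //; apply: prB.
have ji : j != i by rewrite eq_sym.
have split_sum (E : I -> nat) : (\sum_x E x = E i + (E j + \sum_(x | (x != i) && (x != j)) E x))%N.
  by rewrite (bigD1 i) //= (bigD1 j).
move: prF; rewrite !(split_sum (fun x => F x _)) pri prj pri' prj'.
have -> : (\sum_(x | (x != i) && (x != j)) F x (pr' x) =
    \sum_(x | (x != i) && (x != j)) F x (pr x))%N.
  by apply: eq_bigr => x /andP[xi xj]; rewrite prx.
move: Fij; lia.
Qed.

(** * Exchanging vertices between blocks to shrink a sparse half *)

Section SwapHeads.
Variables (V : finType).

Definition swap_head (s s' : seq V) : seq V := take 1 s ++ behead s'.

Lemma swap_head_id s : swap_head s s = s.
Proof. by case: s => // x [|y s]. Qed.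

Lemma swap_head_size L (s s' : L.+1.-tuple V) : size (swap_head s s') == L.+1.
Proof.
by case/tupleP: s => x s; case/tupleP: s' => y s'; rewrite /swap_head /= take0 /= size_tuple.
Qed.

Definition swap_tuple L (s s' : L.+1.-tuple V) : L.+1.-tuple V := Tuple (swap_head_size s s').

(** The new blocks are the old ones read through an injection of positions [(i, l)] that moves only
    the heads. *)
Lemma swap_heads_blocks t L (b : 'I_t -> L.+1.-tuple V) (pr : 'I_t -> 'I_t) :
  blocks b -> involutive pr -> blocks (fun i => swap_tuple (b (pr i)) (b i)).
Proof.
move=> b_blocks prK; pose h (il : 'I_t * 'I_L.+1) := (if il.2 == ord0 then pr il.1 else il.1, il.2).
have h_inj : injective h.
  move=> [i l] [i' l'] [] /= + ll; rewrite -ll.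
  by case: (l == ord0) => [/(can_inj prK)->|->].
have E il : tnth (swap_tuple (b (pr il.1)) (b il.1)) il.2 = tnth (b (h il).1) (h il).2.
  case: il => i l; rewrite /h /= !(tnth_nth (thead (b i))) /=.
  have hs x0 (s s' : L.+1.-tuple V) j :
      nth x0 (swap_head s s') j = nth x0 (if j == 0%N then s else s') j.
    by case/tupleP: s => x s; case/tupleP: s' => y s'; rewrite /swap_head /= take0; case: j.
  by rewrite hs -[l == ord0]val_eqE /=; case: (val l == 0%N).
move=> il il'; rewrite /= !E => /b_blocks; move=> e; apply: h_inj.
by rewrite [LHS]surjective_pairing [RHS]surjective_pairing.
Qed.

End SwapHeads.

Section ExchangeHamiltonian.
Variables (R : realType) (V : finType) (k L t : nat) (H : kgraph k V).
Local Notation m := L.+2.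
Hypotheses (km : k = (m + m)%N) (cV : #|V| = (t * m)%N).
Local Notation g := (edge_seq H).
Variables (f : seq V -> bool) (c2 c tau xi zeta : R).

(** A typical tuple outside [f] is joined to almost all of [f]; members of [f] count as typical. *)
Definition atypical (y : seq V) : bool :=
  zeta < avg (fun x : m.-tuple V => [&& f x, ~~ f y & ~~ g (y ++ x)]%:R).

Definition improving (x y : seq V) : bool :=
  (f (swap_head y x) + f (swap_head x y) < f x + f y)%N &&
  (~~ atypical (swap_head y x) && ~~ atypical (swap_head x y)).

(** Predicates 0 to 2 control degrees, the size of [f] and the atypical blocks; 3 the edges missing
    at a given tuple, later an exchanged block; 4 the tuples outside [f] with degree clearly above
    one half; 5 and 6 supply many blocks with many improving partners each. *)
Definition exchange_predicates (i : nat) (s s' x : seq V) : bool :=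
  match i with
  | 0 => g (s ++ x)
  | 1 => f x
  | 2 => atypical x
  | 3 => [&& f x, ~~ f s & ~~ g (s ++ x)]
  | 4 => ~~ f x && (1 / 2 + c / 4 <= avg (fun y : m.-tuple V => (g (x ++ y))%:R))
  | 5 => improving x s
  | _ => c2 / 4 <= avg (fun y : m.-tuple V => (improving y x)%:R)
  end.

Hypothesis f_perm : perm_invariant f.
Hypothesis f_half : 1 / 2 - zeta <= (avg (fun x : m.-tuple V => (f x)%:R) : R) <= 1 / 2 + zeta.
Hypothesis f_complete :
  avg (fun x : m.-tuple V => avg (fun y : m.-tuple V => [&& f x, ~~ f y & ~~ g (x ++ y)]%:R))
    <= zeta * zeta.
Hypothesis f_dense : c <=
  avg (fun x : m.-tuple V => avg (fun y : m.-tuple V => [&& ~~ f x, ~~ f y & g (x ++ y)]%:R)).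
Hypothesis deg : forall s : m.-tuple V, uniq s ->
  1 / 2 - zeta <= avg (fun x : m.-tuple V => (g (s ++ x))%:R).
Hypotheses (t3 : (2 < t)%N) (zeta0 : 0 < zeta) (xi0 : 0 < xi) (tau0 : 0 < tau).
Hypotheses (xi_tau : xi + 2 * zeta <= tau / 4) (zeta_xi : 4 * zeta <= xi * xi).
Hypotheses (tau_c : 128 * tau <= c) (c1 : c <= 1).
Hypotheses (c2E : c2 = 1 / (512 * m%:R ^+ 2)) (tau_c2 : 32 * tau <= c2) (tau_t : 8 <= tau * t%:R).

Let V0 : (0 < #|V|)%N.
Proof. by rewrite cV muln_gt0 (ltn_trans _ t3). Qed.

Let X0 : (0 < #|{: m.-tuple V}|)%N := card_tuple_gt0 V0 m.

Lemma avg_atypical : avg (fun x : m.-tuple V => (atypical x)%:R) <= zeta.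
Proof.
apply: markov_le => // [x|]; first by apply: avg_ge0 => y; rewrite ler0n.
apply: le_trans f_complete; rewrite avg_exchange; apply: le_avg => x; apply: le_avg => y.
by rewrite edge_seq_sym.
Qed.

(** The tuples produced by an exchange are again uniformly distributed, so insisting that both be
    typical costs at most [2 * zeta] of the drops. *)
Lemma avg_improving :
  2 * (c2 / 4) <= avg (fun y : m.-tuple V => avg (fun x : m.-tuple V => (improving x y)%:R)).
Proof.
have f14 : 1 / 4 <= (avg (fun x : m.-tuple V => (f x)%:R) : R) <= 3 / 4.
  by have /andP[? ?] := f_half; apply/andP; split; move: xi_tau tau_c c1 xi0; lra.
have := exchange_drop V0 f_perm f14; rewrite -c2E => drop.
pose I4 := avg (fun x => avg (fun y => avg (fun r : L.+1.-tuple V => avg (fun p : L.+1.-tuple V =>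
    (improving (x :: r) (y :: p))%:R)))) : R.
have I4E : avg (fun y : m.-tuple V => avg (fun x : m.-tuple V => (improving x y)%:R)) = I4.
  rewrite avg_exchange (avg_tuple_cons _ (fun x => avg (fun y : m.-tuple V => (improving x y)%:R))).
  apply: eq_avg => x; rewrite [RHS]avg_exchange; apply: eq_avg => r.
  by rewrite (avg_tuple_cons _ (fun y => (improving (x :: r) y)%:R)).
have atyp : avg (fun x => avg (fun r : L.+1.-tuple V => (atypical (x :: r))%:R)) <= zeta.
  by have := avg_atypical; rewrite (avg_tuple_cons _ (fun x => (atypical x)%:R)).
suff : c2 <= I4 + (zeta + zeta).
  rewrite I4E; move: xi_tau tau_c2 xi0 zeta0 tau0; lra.
apply: le_trans drop _.
apply: le_trans (_ : avg (fun x => avg (fun y => avg (fun r : L.+1.-tuple V =>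
  avg (fun p : L.+1.-tuple V => (improving (x :: r) (y :: p))%:R +
    ((atypical (y :: r))%:R + (atypical (x :: p))%:R))))) <= _).
  apply: le_avg => x; apply: le_avg => y; apply: le_avg => r; apply: le_avg => p.
  rewrite -!natrD ler_nat /improving /swap_head /= !take0 /=.
  by case: (atypical (y :: r)); case: (atypical (x :: p)); rewrite ?andbF ?andbT ?addn0 //=;
    case: ltnP.
under eq_avg => x do under eq_avg => y do under eq_avg => r do rewrite !avgD (avg_tuple_const V0).
under eq_avg => x do under eq_avg => y do rewrite !avgD (avg_tuple_const V0).
under eq_avg => x do rewrite !avgD (avg_const _ V0).
by rewrite !avgD (avg_const _ V0) lerD2l lerD.
Qed.

Variable b : 'I_t -> m.-tuple V.
Hypothesis b_blocks : blocks b.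
Hypothesis rep : representative zeta exchange_predicates b.

Let N (Q : pred 'I_t) : R := #|[set j | Q j]|%:R.

Let N_le (Q Q' Q'' : pred 'I_t) : (forall j, Q j -> Q' j || Q'' j) -> N Q <= N Q' + N Q''.
Proof.
move=> QQ; rewrite -natrD ler_nat -cardsUI; apply: leq_trans (leq_addr _ _).
by apply/subset_leq_card/subsetP => j; rewrite !inE => /QQ.
Qed.

Let tR : 0 < t%:R :> R. Proof. by rewrite ltr0n (ltn_trans _ t3). Qed.

Let b_uniq i : uniq (b i) := block_uniq (ltn0Sn L.+1) b_blocks i.
Let z0 : m.-tuple V := b (Ordinal (ltn_trans (ltn0Sn 1) t3)).

Let rep_ge i (s s' : m.-tuple V) a : (i < 7)%N ->
  a <= avg (fun x : m.-tuple V => (exchange_predicates i s s' x)%:R) ->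
  (a - zeta) * t%:R <= N (fun j => exchange_predicates i s s' (b j)).
Proof.
move=> i7 ha; have := rep s s' i7; rewrite ler_distl => /andP[h _].
by apply: le_trans h; rewrite mulrBl lerD2r ler_wpM2r // ltW.
Qed.

Let rep_le i (s s' : m.-tuple V) a : (i < 7)%N ->
  avg (fun x : m.-tuple V => (exchange_predicates i s s' x)%:R) <= a ->
  N (fun j => exchange_predicates i s s' (b j)) <= (a + zeta) * t%:R.
Proof.
move=> i7 ha; have := rep s s' i7; rewrite ler_distl => /andP[_ h].
by apply: le_trans h _; rewrite mulrDl lerD2r ler_wpM2r // ltW.
Qed.

Lemma many_improving_pairs : exists (r : nat) (pr : 'I_t -> 'I_t),
  [/\ r%:R <= tau * t%:R < r%:R + 1, involutive pr, #|[set i | pr i != i]| = (2 * r)%N,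
     forall i, pr i != i -> ~~ atypical (swap_tuple (b (pr i)) (b i)) &
     (\sum_i f (swap_tuple (b (pr i)) (b i)) + r <= \sum_i f (b i))%N].
Proof.
pose r := Num.truncn (tau * t%:R).
have r1 : r%:R <= tau * t%:R < r%:R + 1.
  by rewrite natr1 truncnS_gt truncn_le // mulr_ge0 // ltW.
have small : (2 * r)%:R <= (c2 / 4 - zeta) * t%:R.
  have /andP[h _] := r1; rewrite natrM; apply: le_trans (_ : 2 * tau * t%:R <= _).
    by rewrite -mulrA ler_pM2l.
  rewrite ler_pM2r //; move: xi_tau tau_c2 xi0 zeta0 tau0; lra.
pose J := [set j | exchange_predicates 6 z0 z0 (b j)].
have J_big : (2 * r <= #|J|)%N.
  rewrite -(ler_nat R); apply: le_trans small _; apply: rep_ge => //.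
  apply: markov_ge avg_improving => //; first by move: tau_c2 tau0; lra.
  by move=> x; apply: avg_le1.
have row_big j : j \in J -> (2 * r <= #|[set i | improving (b i) (b j)]|)%N.
  rewrite inE => jJ; rewrite -(ler_nat R); apply: le_trans small _.
  exact: (@rep_ge 5 (b j) z0).
have [|pr [prK cU prB prF]] := @greedy_pairing _
    (fun i j => f (swap_head (b j) (b i)) : nat)
    (fun i j => atypical (swap_head (b j) (b i))) J _ J_big _ r (leqnn _).
  move=> j /row_big h; apply: leq_trans h _; apply/subset_leq_card/subsetP => i.
  by rewrite !inE /improving !swap_head_id.
exists r, pr; split=> //.
have E : (\sum_i f (b i) = \sum_i f (swap_head (b i) (b i)))%N.
  by apply: eq_bigr => i _; rewrite swap_head_id.
by rewrite E.
Qed.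

(** After the exchanges more than half of the blocks lie outside [f], with a margin. An unmoved
    block of [f] that misses few of them has degree at least $t/2$; so does an unmoved block outside
    [f] of degree near $1/2+c/4$. As $c/4\ge 32\tau$, these two kinds exceed $t/2+3\tau t$, which
    makes up for a minimum degree of about $(1/2-3\tau)t$ in [closure_hamiltonian]. *)
Lemma exchange_hamiltonian : exists2 b' : 'I_t -> m.-tuple V, blocks b' &
  hamiltonian (fun i j => g (b' i ++ b' j)).
Proof.
have [r [pr [/andP[r1 r2] prK cU prA prF]]] := many_improving_pairs.
pose b' i := swap_tuple (b (pr i)) (b i).
have b'_blocks : blocks b' by apply: swap_heads_blocks.
exists b' => //.
have b'_uniq i : uniq (b' i) := block_uniq (ltn0Sn L.+1) b'_blocks i.
have b'E i : pr i = i -> b' i = b i.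
  by move=> E; apply: val_inj; rewrite /= E swap_head_id.
have [fh1 fh2] : 1 / 2 - zeta <= (avg (fun x : m.-tuple V => (f x)%:R) : R) /\
   (avg (fun x : m.-tuple V => (f x)%:R) : R) <= 1 / 2 + zeta by apply/andP.
have NT : N predT = t%:R by rewrite /N (_ : [set j | predT j] = [set: 'I_t]) ?cardsT ?card_ord //;
  apply/setP => j; rewrite !inE.
have NC Q : N (fun j => ~~ Q j) = t%:R - N Q.
  have <- : N Q + N (fun j => ~~ Q j) = t%:R; last by rewrite addrC addKr.
  rewrite -natrD -[in RHS](card_ord t) -(cardsC [set j | Q j]); congr (_ + _)%N%:R.
  by apply: eq_card => j; rewrite !inE.
have U_small : N (fun i => pr i != i) <= 2 * tau * t%:R.
  by rewrite /N cU natrM -mulrA ler_pM2l.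
pose dg i := N (fun j => g (b' i ++ b' j)).
have deg_swap i : N (fun j => g (b' i ++ b j)) <= dg i + 2 * tau * t%:R.
  apply: le_trans (lerD (lexx _) U_small); apply: N_le => j gj.
  by have [/b'E->|_] := eqVneq (pr j) j; rewrite ?gj ?orbT.
have deg_all i : (1 / 2 - 2 * zeta - 2 * tau) * t%:R <= dg i.
  have := deg_swap i; have := @rep_ge 0 (b' i) z0 _ isT (deg (b'_uniq i)).
  by rewrite /=; lra.
have If1 : (1 / 2 - 2 * zeta) * t%:R <= N (fun i => f (b i)).
  by have := @rep_ge 1 z0 z0 _ isT fh1; rewrite /=; lra.
have If2 : N (fun i => f (b i)) <= (1 / 2 + 2 * zeta) * t%:R.
  by have := @rep_le 1 z0 z0 _ isT fh2; rewrite /=; lra.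
have If' : N (fun i => f (b' i)) + r%:R <= N (fun i => f (b i)).
  have NE (Q : pred 'I_t) : N Q = (\sum_i Q i)%N%:R.
    by rewrite /N -sum1dep_card big_mkcond /=; congr (_%:R); apply: eq_bigr.
  by rewrite !NE -natrD ler_nat.
pose M i := N (fun j => ~~ f (b' j) && ~~ g (b i ++ b' j)).
(* Counted from the side of [j]: exchanged blocks are typical by the choice of pairs, so at most
   [2 * zeta * t] blocks are atypical, each costing at most [t]; a typical one costs at most
   [2 * zeta * t]. *)
have sum_M : \sum_(i | f (b i)) M i <= 4 * zeta * t%:R * t%:R.
  have -> : \sum_(i | f (b i)) M i =
      \sum_j N (fun i => [&& f (b i), ~~ f (b' j) & ~~ g (b' j ++ b i)]).
    have NE (Q : pred 'I_t) : N Q = \sum_i (Q i)%:R.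
      rewrite /N -sum1dep_card natr_sum big_mkcond /=; apply: eq_bigr => i _.
      by case: ifP.
    under eq_bigr => i _ do rewrite /M NE.
    under [RHS]eq_bigr => j _ do rewrite NE.
    rewrite big_mkcond [RHS]exchange_big /=; apply: eq_bigr => i _.
    case: (f (b i)) => /=; last by rewrite big1.
    by apply: eq_bigr => j _; rewrite edge_seq_sym.
  have atyp2 : N (fun j => atypical (b j)) <= 2 * zeta * t%:R.
    by have := @rep_le 2 z0 z0 _ isT avg_atypical; rewrite /=; lra.
  apply: le_trans (_ : \sum_(j < t) (2 * zeta * t%:R + t%:R * (atypical (b j))%:R) <= _).
    apply: ler_sum => j _.
    have [aj|naj] := boolP (atypical (b' j)).
      have prj : pr j = j by apply/eqP; apply: contraLR aj => /prA.
      rewrite b'E // in aj; rewrite aj mulr1; apply: le_trans (_ : t%:R <= _).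
        by rewrite -NT ler_nat; apply/subset_leq_card/subsetP => i; rewrite !inE.
      by rewrite lerDr !mulr_ge0 // ltW.
    have := @rep_le 3 (b' j) z0 zeta isT; rewrite /= => /(_ _)/le_trans; apply.
      by move: naj; rewrite /atypical -leNgt.
    have : 0 <= t%:R * (atypical (b j))%:R :> R by rewrite mulr_ge0 // ltW.
    lra.
  rewrite big_split /= sumr_const card_ord -mulr_sumr -[_ *+ t]mulr_natr.
  have -> : \sum_(j < t) (atypical (b j))%:R = N (fun j => atypical (b j)).
    rewrite /N -sum1dep_card natr_sum [RHS]big_mkcond /=; apply: eq_bigr => i _.
    by case: (atypical _).
  have := ler_wpM2l (ltW tR) atyp2; lra.
pose X (i : 'I_t) := f (b i) && (xi * t%:R < M i).
have X_small : N X <= xi * t%:R.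
  have xt : 0 < xi * t%:R by rewrite mulr_gt0.
  rewrite -(ler_pM2r xt); apply: le_trans (_ : \sum_(i | f (b i)) M i <= _).
    rewrite /N -sum1dep_card natr_sum mulr_suml [leRHS](bigID (fun i => xi * t%:R < M i)) /=.
    rewrite -[leLHS]addr0 lerD //; last by apply: sumr_ge0 => i _; rewrite ler0n.
    by apply: ler_sum => i /andP[_ /ltW]; rewrite mul1r.
  apply: le_trans sum_M _; have := ler_wpM2r (ltW tR) (ler_wpM2r (ltW tR) zeta_xi); lra.
pose Gd i := [&& f (b i), pr i == i & M i <= xi * t%:R].
pose K i := exchange_predicates 4 z0 z0 (b i).
pose Kd i := K i && (pr i == i).
have Gd_big : (1 / 2 - 2 * zeta - 2 * tau - xi) * t%:R <= N Gd.
  have : N (fun i => f (b i)) <= N Gd + N (fun i => X i || (pr i != i)).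
    apply: N_le => i fi; rewrite /Gd /X fi /= leNgt.
    by case: (xi * _ < _); case: (pr i == i).
  have : N (fun i => X i || (pr i != i)) <= N X + N (fun i => pr i != i) by apply: N_le.
  lra.
have Gd_deg i : Gd i -> t%:R <= 2 * dg i.
  case/and3P=> fi /eqP pri Mi.
  have : N (fun j => ~~ f (b' j)) <= dg i + M i.
    by apply: N_le => j fj; rewrite b'E // fj; case: (g _).
  rewrite NC; have := ler_wpM2r (ltW tR) xi_tau; have : 0 <= zeta * t%:R by rewrite mulr_ge0 // ltW.
  move: tau_t Mi If' If2 r2; lra.
(* A proportion $c/2$ of tuples lies outside [f] and has neighbour density $c/2$ there; the typical
   ones among them are also joined to almost all of [f], of density about $1/2$. *)
have avg_K : c / 4 <= avg (fun x : m.-tuple V => (exchange_predicates 4 z0 z0 x)%:R).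
  pose F (x : m.-tuple V) := avg (fun y : m.-tuple V => [&& ~~ f x, ~~ f y & g (x ++ y)]%:R) : R.
  have c0 : 0 < c / 2 by move: tau_c tau0; lra.
  have : c / 2 <= avg (fun x => (c / 2 <= F x)%R%:R).
    apply: markov_ge => //; first exact: ltW.
      by move=> x; apply: avg_le1.
    by move: f_dense; rewrite -/F; lra.
  have : avg (fun x => (c / 2 <= F x)%R%:R) <=
      avg (fun x : m.-tuple V => (exchange_predicates 4 z0 z0 x)%:R) + zeta.
    apply: le_trans (lerD (lexx _) avg_atypical); rewrite -avgD; apply: le_avg => x.
    rewrite -natrD ler_nat /=.
    have [Fx|//] := leP (c / 2) (F x).
    have [fx|nfx] /= := boolP (f x).
      move: Fx; rewrite /F fx /= avg_const //; move: c0; lra.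
    have [//|nax] := boolP (atypical x); rewrite ?addn1 // addn0.
    rewrite lt0n eqb0 negbK.
    have : F x + avg (fun y : m.-tuple V => (f y)%:R) <=
       avg (fun y : m.-tuple V => (g (x ++ y))%:R) +
       avg (fun y : m.-tuple V => [&& f y, ~~ f x & ~~ g (x ++ y)]%:R).
      rewrite /F -!avgD; apply: le_avg => y; rewrite -!natrD ler_nat nfx /=.
      by case: (f y); case: (g _).
    move: nax; rewrite /atypical -leNgt; move: fh1 Fx xi_tau tau_c xi0 zeta0; lra.
  move: xi_tau tau_c xi0 zeta0; lra.
have Kd_big : (c / 4 - zeta - 2 * tau) * t%:R <= N Kd.
  have : N K <= N Kd + N (fun i => pr i != i).
    by apply: N_le => i; rewrite /Kd => ->; case: (pr i == i).
  have := @rep_ge 4 z0 z0 _ isT avg_K; rewrite -/K; move: U_small; lra.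
have Kd_deg i : Kd i -> t%:R <= 2 * dg i.
  case/andP=> /andP[_ Ki] /eqP pri.
  have := deg_swap i; rewrite b'E //; have := @rep_ge 0 (b i) z0 _ isT Ki; rewrite /=.
  have : 0 <= (c / 4 - zeta - 2 * tau) * t%:R.
    by rewrite mulr_ge0 //; move: xi_tau tau_c xi0 zeta0 tau0; lra.
  lra.
pose Hi := [set i | Gd i || Kd i].
have Hi_big : N Gd + N Kd <= #|Hi|%:R.
  rewrite -natrD ler_nat -cardsUI [_ :&: _](_ : _ = set0) ?cards0 ?addn0.
    by apply/subset_leq_card/subsetP => i; rewrite !inE.
  apply/setP => i; rewrite !inE /Gd /Kd /K /=.
  by case: (f (b i)); rewrite ?andbF.
pose d := Num.truncn ((1 / 2 - 3 * tau) * t%:R).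
have coef0 : 0 <= 1 / 2 - 3 * tau by move: tau_c c1; lra.
have d1 : d%:R <= (1 / 2 - 3 * tau) * t%:R by rewrite truncn_le // mulr_ge0 // ltW.
have d2 : (1 / 2 - 3 * tau) * t%:R < d%:R + 1 by rewrite natr1; apply: truncnS_gt.
have z_t : 0 <= zeta * t%:R by rewrite mulr_ge0 // ltW.
have x_t : 0 <= xi * t%:R by rewrite mulr_ge0 // ltW.
have xt_t := ler_wpM2r (ltW tR) xi_tau.
have tc_t := ler_wpM2r (ltW tR) tau_c.
apply: (@closure_hamiltonian _ _ Hi d).
- by rewrite card_ord.
- by move=> i j; rewrite edge_seq_sym.
- by move=> i; rewrite (edge_seq_irr H (ltn0Sn L.+1) km).
- move=> i; rewrite -(ler_nat R); apply: le_trans d1 _; apply: le_trans (deg_all i).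
  move: xt_t; lra.
- move=> i; rewrite inE card_ord -(ler_nat R) natrM => /orP[/Gd_deg|/Kd_deg] //.
- rewrite card_ord -(ltr_nat R) natrD; move: Hi_big Gd_big Kd_big d2 xt_t tc_t tau_t; lra.
- rewrite card_ord -(ler_nat R) natrM; move: Hi_big Gd_big Kd_big xt_t tc_t tau_t; lra.
Qed.

End ExchangeHamiltonian.

(** * The non-extremal case *)

Section Extremal.
Variables (R : realType) (V : finType) (k L : nat) (H : kgraph k V).
Local Notation m := L.+2.
Hypotheses (km : k = (m + m)%N) (V0 : (0 < #|V|)%N).
Local Notation g := (edge_seq H).

Lemma half_split_close (f : seq V -> bool) (c : bool) (sigma delta eps : R) :
  perm_invariant f -> 0 < eps -> 0 <= sigma ->
  1 / 2 - sigma <= (avg (fun x : m.-tuple V => (f x)%:R) : R) <= 1 / 2 + sigma ->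
  2 * (sigma * sigma) <= delta ->
  avg (fun x : m.-tuple V => avg (fun y : m.-tuple V => (g (x ++ y) != f x (+) f y (+) c)%:R))
    <= delta ->
  2 * (8 * m + 3)%:R * delta <= (eps / k%:R) ^+ k -> (8 * m + 1)%:R * delta <= eps / 4 ->
  k%:R / #|V|%:R <= eps / 4 ->
  exists2 A : {set V}, balanced A & eps_close eps H (parity_kgraph k c A).
Proof.
move=> f_perm eps0 s0 /andP[f1 f2] sd hyp hb he hn.
have X0 := card_tuple_gt0 V0 m.
have k0 : 0 < k%:R :> R by rewrite ltr0n km.
have [chi hchi] := parity_of_sum V0 (edge_seq_perm H) f_perm hyp.
(* [kappa]: the density of [f x (+) f y (+) c] differs from $1/2$ by at most $2\sigma^2\le\delta$,
   and [hyp] costs another $\delta$. [beta]: its share $k\beta/2$ of the error is then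
   $\mathrm{eps}/2$, leaving a quarter each to $\delta$ and to rounding. *)
apply: (parity_close (m := m) V0 _ km hchi (kappa := 2 * delta) (beta := eps / k%:R)) => //.
- set p := (avg (fun x : m.-tuple V => (f x)%:R) : R) in f1 f2.
  pose q := avg (fun x : m.-tuple V => avg (fun y : m.-tuple V => (f x (+) f y (+) c)%:R)) : R.
  have qE : `|q - 1 / 2| <= delta.
    have neqE : avg (fun x : m.-tuple V => avg (fun y : m.-tuple V => (f x (+) f y)%:R)) =
        2 * (p * (1 - p)) :> R.
      by rewrite -avg_neq //; apply: eq_avg => x; apply: eq_avg => y; case: (f x); case: (f y).
    have : q = 2 * (p * (1 - p)) \/ q = 1 - 2 * (p * (1 - p)).
      rewrite -neqE /q; case: c {hyp hchi q}; [right|left]; last first.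
        by apply: eq_avg => x; apply: eq_avg => y; rewrite addbF.
      apply/eqP; rewrite eq_sym subr_eq -avgD; apply/eqP.
      rewrite -[LHS](avg_const 1 X0); apply: eq_avg => x.
      rewrite -avgD -[LHS](avg_const 1 X0); apply: eq_avg => y.
      by case: (f x); case: (f y); rewrite ?add0r ?addr0.
    have ps : (p - 1 / 2) * (p - 1 / 2) <= sigma * sigma.
      have [le|lt] := leP (1 / 2) p.
        by apply: ler_pM; lra.
      by rewrite -mulrNN; apply: ler_pM; lra.
    have p2 : 0 <= (p - 1 / 2) * (p - 1 / 2) by rewrite -expr2 sqr_ge0.
    rewrite ler_distl; case=> ->; lra.
  have gq : `|avg (fun x : m.-tuple V => avg (fun y : m.-tuple V => (g (x ++ y))%:R)) - q| <= delta.
    rewrite ler_distl lerBlDr; apply/andP; split.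
      apply: le_trans (lerD (lexx _) hyp); rewrite -avgD; apply: le_avg => x.
      rewrite -avgD; apply: le_avg => y; rewrite -natrD ler_nat.
      by case: (g _); case: (f x); case: (f y); case: (c).
    apply: le_trans (lerD (lexx _) hyp); rewrite -avgD; apply: le_avg => x.
    rewrite -avgD; apply: le_avg => y; rewrite -natrD ler_nat.
    by case: (g _); case: (f x); case: (f y); case: (c).
  by move: qE gq; rewrite !ler_distl; lra.
- by rewrite divr_gt0.
- by apply: le_trans hb; rewrite !natrD !natrM; lra.
have -> : k%:R * (eps / k%:R / 2 + 1 / #|V|%:R) = eps / 2 + k%:R / #|V|%:R.
  have n0 : 0 < #|V|%:R :> R by rewrite ltr0n.
  by move: k0 n0; move: (k%:R : R) (#|V|%:R : R) => x y x0 y0; field; rewrite !gt_eqF.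
by move: he hn; lra.
Qed.

Lemma hamilton_cycle_of_order t (b : 'I_t -> m.-tuple V) : (2 < t)%N -> #|V| = (t * m)%N ->
  blocks b -> hamiltonian (fun i j => g (b i ++ b j)) -> contains_hamilton_cycle m H.
Proof.
move=> t3 cV b_blocks [c [uc sc cc]]; rewrite card_ord in sc.
exact: (blocks_hamilton_cycle (ltn0Sn L.+1) t3 km cV b_blocks uc sc cc).
Qed.

Section Core.
Variables (eps delta c c2 tau xi zeta omega sigma eta : R) (t : nat).
Hypotheses (eps0 : 0 < eps) (t3 : (2 < t)%N) (cV : #|V| = (t * m)%N).
Hypotheses (tau0 : 0 < tau) (xi0 : 0 < xi) (zeta0 : 0 < zeta) (omega0 : 0 < omega).
Hypotheses (sigma0 : 0 < sigma) (eta0 : 0 < eta).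
Hypotheses (delta_beta : 2 * (8 * m + 3)%:R * delta <= (eps / k%:R) ^+ k)
  (delta_eps : (8 * m + 1)%:R * delta <= eps / 4) (k_small : k%:R / #|V|%:R <= eps / 4).
Hypotheses (sigma_delta : 2 * (sigma * sigma) <= delta) (clique_delta : 14 * sigma + 4 * omega <= delta)
  (bip_delta : 9 * sigma + 3 * omega + c <= delta) (sigma_omega : 5 * sigma <= omega * omega)
  (omega_zeta : 4 * sigma + omega <= zeta * zeta).
Hypotheses (xi_tau : xi + 2 * zeta <= tau / 4) (zeta_xi : 4 * zeta <= xi * xi)
  (tau_c : 128 * tau <= c) (c1 : c <= 1) (c2E : c2 = 1 / (512 * m%:R ^+ 2)) (tau_c2 : 32 * tau <= c2).
Hypotheses (eta_sigma : 16 * eta <= sigma / 2) (sigma16 : sigma / 2 <= 1 / 16) (eta_zeta : 9 * eta <= zeta).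
Hypotheses (eta_t : 2 < eta * t%:R) (tau_t : 8 <= tau * t%:R).
Hypothesis deg : forall s : m.-tuple V, uniq s ->
  1 / 2 - eta <= avg (fun x : m.-tuple V => (g (s ++ x))%:R).
Hypothesis nonuniq : avg (fun s : m.-tuple V => (~~ uniq s)%:R) <= sigma.
Hypothesis sample : forall (a : R) (P : nat -> seq V -> seq V -> seq V -> bool),
  a = eta \/ a = zeta -> exists2 b : 'I_t -> m.-tuple V, blocks b & representative a P b.
Hypothesis not_close : forall A : {set V}, balanced A ->
  ~ eps_close eps H (odd_kgraph k A) /\ ~ eps_close eps H (even_kgraph k A).

Lemma nonextremal_hamilton_cycle : contains_hamilton_cycle m H.
Proof.
have X0 := card_tuple_gt0 V0 m.
have g_sym s s' : g (s ++ s') = g (s' ++ s) := edge_seq_sym H s s'.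
pose G (x y : m.-tuple V) := g (x ++ y).
have G_sym : symmetric G by move=> x y; apply: g_sym.
have eta_sigma' : 9 * eta <= sigma by move: eta_sigma eta0; lra.
have deg_le a (s : m.-tuple V) : 9 * eta <= a -> uniq s ->
    1 / 2 - a <= avg (fun x : m.-tuple V => (g (s ++ x))%:R).
  by move=> ha /deg; apply: le_trans; move: eta0; lra.
pose linked (s s' : m.-tuple V) := avg (fun x : m.-tuple V => avg (fun y : m.-tuple V =>
  (~~ g (s ++ x) && (~~ g (s' ++ y) && g (x ++ y)))%:R)) : R.
pose half (s : m.-tuple V) := 1 / 2 - 9 * eta <= avg (fun x : m.-tuple V => (~~ g (s ++ x))%:R).
have [/existsP[s0 /existsP[s1 /and5P[us0 us1 h0 h1 /ltW link]]]|no_pair] := boolP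
    [exists s : m.-tuple V, exists s' : m.-tuple V,
      [&& uniq s, uniq s', half s, half s' & linked s s' < sigma]]; last first.
  have [b b_blocks rep] := sample (linked_predicates m H (sigma / 2)) (or_introl erefl).
  apply: (hamilton_cycle_of_order t3 cV b_blocks).
  apply: (linked_hamiltonian (ltn0Sn L.+1) km cV b_blocks eta0 eta_sigma sigma16 eta_t t3 deg _ rep).
  move=> s s' us us' hs hs'; have -> : 2 * (sigma / 2) = sigma by field.
  rewrite leNgt; apply: contra no_pair => lt.
  by apply/existsP; exists s; apply/existsP; exists s'; rewrite us us' /half hs hs'.
pose f x := ~~ g (s0 ++ x).
have f_perm : perm_invariant f.
  by move=> x y xy; congr negb; apply: edge_seq_perm; rewrite perm_cat2l.
have f_half a : 9 * eta <= a ->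
    1 / 2 - a <= (avg (fun x : m.-tuple V => (f x)%:R) : R) <= 1 / 2 + a.
  move=> ha; apply/andP; split; first by apply: le_trans h0; rewrite lerD2l lerN2.
  by rewrite avg_negb //; have := deg_le a s0 ha us0; lra.
have not_split col : ~ avg (fun x : m.-tuple V => avg (fun y : m.-tuple V =>
    (g (x ++ y) != f x (+) f y (+) col)%:R)) <= delta.
  move=> hyp; have [A balA close] := half_split_close f_perm eps0 (ltW sigma0)
    (f_half _ eta_sigma') sigma_delta hyp delta_beta delta_eps k_small.
  by have [] := not_close balA; case: (col) close.
have /andP[f1 _] := f_half _ eta_sigma'.
have h1' : 1 / 2 - sigma <= avg (fun x : m.-tuple V => (~~ g (s1 ++ x))%:R).
  by apply: le_trans h1; rewrite lerD2l lerN2.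
(* The first alternative is a pair of near-cliques, the even pattern. In the second, a sparse
   complement of [f] would give a nearly complete bipartite graph, the odd pattern. *)
have [hyp|[fE fC]] := half_dichotomy X0 G_sym (ltW sigma0) (deg_le _ ^~ eta_sigma') nonuniq f1 h1'
    link omega0 sigma_omega.
  by case: (@not_split true); apply: le_trans hyp clique_delta.
have f_dense : c <= avg (fun x : m.-tuple V => avg (fun y : m.-tuple V =>
    [&& ~~ f x, ~~ f y & g (x ++ y)]%:R)).
  rewrite leNgt; apply/negP => /ltW sparse; apply: (@not_split false).
  have fC' : avg (fun x : m.-tuple V => avg (fun y : m.-tuple V =>
      [&& ~~ f x, f y & ~~ g (x ++ y)]%:R)) <= 4 * sigma + omega.
    apply: le_trans fC; rewrite avg_exchange; apply: le_avg => x; apply: le_avg => y.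
    by rewrite ler_nat /G g_sym andbCA.
  apply: le_trans (_ : avg (fun x : m.-tuple V => avg (fun y : m.-tuple V =>
    [&& f x, f y & G x y]%:R + [&& f x, ~~ f y & ~~ G x y]%:R +
    ([&& ~~ f x, f y & ~~ g (x ++ y)]%:R + [&& ~~ f x, ~~ f y & g (x ++ y)]%:R))) <= _).
    apply: le_avg => x; apply: le_avg => y; rewrite -!natrD ler_nat /G.
    by case: (f x); case: (f y); case: (g _).
  under eq_avg => x do rewrite !avgD.
  rewrite !avgD; apply: le_trans (lerD (lerD fE fC) (lerD fC' sparse)) _.
  by move: bip_delta; lra.
have [b b_blocks rep] := sample (exchange_predicates L H f c2 c zeta) (or_intror erefl).
have [b' b'_blocks ham] := exchange_hamiltonian km cV f_perm (f_half _ eta_zeta)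
  (le_trans fC omega_zeta) f_dense (deg_le _ ^~ eta_zeta) t3 zeta0 xi0 tau0 xi_tau zeta_xi
  tau_c c1 c2E tau_c2 tau_t b_blocks rep.
exact: (hamilton_cycle_of_order t3 cV b'_blocks ham).
Qed.

End Core.

End Extremal.

(** Each use of Markov's inequality takes a square root, so [zeta], [omega] and [sigma] are
    multiples of the square of their predecessor. [tau] also stays below [c2], since the exchanges
    cannot outnumber the supply of improving pairs. *)
Lemma nonextremal_constants (R : realType) (a b e c2 : R) :
  0 < a -> 0 < b -> 0 < e -> 0 < c2 -> c2 <= 1 / 2048 ->
  forall beta : R, 0 < beta ->
  exists delta c tau xi zeta omega sigma eta : R,
  [/\ [/\ 0 < tau, 0 < xi, 0 < zeta & 0 < omega], 0 < sigma /\ 0 < eta,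
    [/\ a * delta <= beta, b * delta <= e, 2 * (sigma * sigma) <= delta &
      14 * sigma + 4 * omega <= delta],
    [/\ 9 * sigma + 3 * omega + c <= delta, 5 * sigma <= omega * omega,
      4 * sigma + omega <= zeta * zeta & xi + 2 * zeta <= tau / 4] &
    [/\ 4 * zeta <= xi * xi, 128 * tau <= c, c <= 1 & 32 * tau <= c2] /\
    [/\ 16 * eta <= sigma / 2, sigma / 2 <= 1 / 16, 9 * eta <= zeta & 4 * eta <= tau]].
Proof.
move=> a0 b0 e0 c20 c21 beta beta0.
have [delta [delta0 delta1 delta_a delta_b]] : exists delta : R,
    [/\ 0 < delta, delta <= 1, a * delta <= beta & b * delta <= e].
  exists (Num.min 1 (Num.min (beta / a) (e / b))); split.
  - by rewrite !lt_min ltr01 !divr_gt0.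
  - by rewrite ge_min lexx.
  - by rewrite mulrC -ler_pdivlMr // !ge_min lexx orbT.
  - by rewrite mulrC -ler_pdivlMr // !ge_min lexx !orbT.
have [tau tauE] : exists tau : R, tau = delta * c2 / 32 by exists (delta * c2 / 32).
have tau0 : 0 < tau by rewrite tauE divr_gt0 // mulr_gt0.
have tau_c2 : 32 * tau <= c2.
  by rewrite tauE; have := ler_wpM2r (ltW c20) delta1; lra.
have tau_c : 128 * tau <= delta / 2.
  by rewrite tauE; have := ler_wpM2l (ltW delta0) c21; lra.
have square (x : R) : 0 < x -> x <= 1 -> 0 < x * x /\ x * x <= x.
  by move=> x0 x1; rewrite mulr_gt0 // ler_piMr // ltW.
have [xi xiE] : exists xi : R, xi = tau / 8 by exists (tau / 8).
have [||xi0 xi1] := square xi; [by lra|by lra|].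
have [zeta zetaE] : exists zeta : R, zeta = xi * xi / 4 by exists (xi * xi / 4).
have [||zeta0 zeta1] := square zeta; [by lra|by lra|].
have [omega omegaE] : exists omega : R, omega = zeta * zeta / 2 by exists (zeta * zeta / 2).
have [||omega0 omega1] := square omega; [by lra|by lra|].
have [sigma sigmaE] : exists sigma : R, sigma = omega * omega / 8 by exists (omega * omega / 8).
have [||sigma0 sigma1] := square sigma; [by lra|by lra|].
exists delta, (delta / 2), tau, xi, zeta, omega, sigma, (sigma / 32).
by split; [split|split|split|split|split; split] => //; lra.
Qed.

Lemma hamilton_cycle_nonextremal (R : realType) (k L d : nat) (eps : R) :
  k = (L.+2 + L.+2)%N -> (L.+2 <= d <= k)%N -> 0 < eps ->
  exists (gamma : R) (n1 : nat), 0 < gamma /\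
    forall (V : finType) (H : kgraph k V), (n1 <= #|V|)%N -> (L.+2 %| #|V|)%N ->
    (forall A : {set V}, balanced A ->
       ~ eps_close eps H (odd_kgraph k A) /\ ~ eps_close eps H (even_kgraph k A)) ->
    (1 / 2 - gamma) * 'C(#|V| - d, k - d)%:R <= (min_degree d H)%:R ->
    contains_hamilton_cycle L.+2 H.
Proof.
set m := L.+2 => km hd eps0.
have m0 : (0 < m)%N by [].
have k0 : 0 < k%:R :> R by rewrite ltr0n km.
have beta0 : 0 < (eps / k%:R) ^+ k by rewrite exprn_gt0 // divr_gt0.
have a0 : 0 < 2 * (8 * m + 3)%:R :> R by rewrite mulr_gt0 // ltr0n.
have b0 : 0 < (8 * m + 1)%:R :> R by rewrite ltr0n.
have m2 : 4 <= m%:R ^+ 2 :> R by rewrite -natrX ler_nat -[4%N]/(2 ^ 2)%N leq_exp2r.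
have c20 : 0 < 1 / (512 * m%:R ^+ 2) :> R by rewrite divr_gt0 // mulr_gt0 //; lra.
have c21 : 1 / (512 * m%:R ^+ 2) <= 1 / 2048 :> R.
  by rewrite ler_pdivrMr ?mulr_gt0 //; lra.
have e0 : 0 < eps / 4 by rewrite divr_gt0.
have [delta [c [tau [xi [zeta [omega [sigma [eta [[tau0 xi0 zeta0 omega0] [sigma0 eta0]
  [delta_beta delta_eps sigma_delta clique_delta] [bip_delta sigma_omega omega_zeta xi_tau]
  [[zeta_xi tau_c c1 tau_c2] [eta_sigma sigma16 eta_zeta eta_tau]]]]]]]]]]] :=
  nonextremal_constants a0 b0 e0 c20 c21 beta0.
have [n2 n2P] := sampling_predicates m0 eta0.
have [n3 n3P] := sampling_predicates m0 zeta0.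
have [n4 n4P] : exists n4 : nat, forall n : nat, (n4 <= n)%N ->
    [/\ 2 * (m * k)%:R / eta < n%:R, 4 * k%:R / eps < n%:R & 8 * m%:R / eta < n%:R].
  pose z1 := 2 * (m * k)%:R / eta; pose z2 := 4 * k%:R / eps; pose z3 := 8 * m%:R / eta.
  exists (maxn (Num.truncn z1).+1 (maxn (Num.truncn z2).+1 (Num.truncn z3).+1)) => n.
  rewrite !geq_max => /and3P[h1 h2 h3].
  by split; apply: lt_le_trans (truncnS_gt _) _; rewrite ler_nat.
(* Half of [eta] goes to [gamma], half to the loss [(m * k) / n] in passing from sets to tuples. *)
exists (eta / 2), (maxn n4 (maxn n2 n3)); split; first by rewrite divr_gt0.
move=> V H; rewrite !geq_max => /and3P[/n4P[l1 l2 l3] nV2 nV3] /dvdnP[t cV] not_close hdeg.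
have z1 : 0 <= 8 * m%:R / eta by rewrite divr_ge0 ?mulr_ge0 ?ler0n // ltW.
have nR : 0 < #|V|%:R :> R by apply: le_lt_trans l3.
have V0 : (0 < #|V|)%N by rewrite -(ltr_nat R).
have eta1 : eta <= 1 / 32 by clear -eta_sigma sigma16; lra.
have mk_small : (m * k)%:R / #|V|%:R <= eta / 2.
  move: l1; rewrite ltr_pdivrMr // => l1; rewrite ler_pdivrMr //.
  by clear -l1; lra.
have k_small : k%:R / #|V|%:R <= eps / 4.
  move: l2; rewrite ltr_pdivrMr // => l2; rewrite ler_pdivrMr //.
  by clear -l2; lra.
have eta_t : 8 < eta * t%:R.
  have mR : 0 < m%:R :> R by rewrite ltr0n.
  have E : eta * t%:R * m%:R = #|V|%:R * eta by rewrite cV natrM; ring.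
  by rewrite -(ltr_pM2r mR) E -ltr_pdivrMr.
have t3 : (2 < t)%N.
  rewrite -(ltr_nat R) ltNge; apply/negP => t2.
  have := ler_wpM2l (ltW eta0) t2; clear -eta_t eta1; lra.
have kn : (k <= #|V|)%N.
  rewrite -(ler_nat R); apply: le_trans (_ : (m * k)%:R <= _).
    by rewrite ler_nat leq_pmull.
  move: mk_small; rewrite ler_pdivrMr // => /le_trans; apply.
  by rewrite ler_piMl ?ler0n //; clear -eta1; lra.
apply: (@nonextremal_hamilton_cycle R V k L H km V0 eps delta c _ tau xi zeta omega sigma eta t
  eps0 t3 cV tau0 xi0 zeta0 omega0 sigma0 eta0 delta_beta delta_eps k_small sigma_delta
  clique_delta bip_delta sigma_omega omega_zeta xi_tau zeta_xi tau_c c1 erefl tau_c2 eta_sigma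
  sigma16 eta_zeta).
- by apply: lt_trans eta_t; rewrite ltr_nat.
- apply: le_trans (ltW eta_t) _; rewrite ler_wpM2r ?ler0n //.
  by clear -eta_tau eta0; lra.
- move=> s us; have g0 : 0 <= 1 / 2 - eta / 2 by clear -eta1; lra.
  have g1 : 1 / 2 - eta / 2 <= 1 by clear -eta0; lra.
  apply: le_trans _ (tuple_degree V0 km kn us hd g0 g1 hdeg).
  by clear -mk_small; lra.
- apply: le_trans (avg_nonuniq R V0 km kn) _; apply: le_trans mk_small _.
  by clear -eta_sigma eta0 sigma0; lra.
- have t0 : (0 < t)%N by rewrite (ltn_trans _ t3).
  by move=> a P [->|->]; [apply: n2P|apply: n3P].
exact: not_close.
Qed.

Unset Implicit Arguments.

Theorem theorem1p5 (R : realType) (k : nat) (hk4 : (4 <= k)%N)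
    (hkeven : ~~ odd k) (d : nat) (hd : (k./2 <= d <= k.-1)%N)
    (eps : R) (heps : 0 < eps) :
  exists (gamma : R) (n1 : nat), 0 < gamma /\
    forall (n : nat), (n1 <= n)%N -> (k./2 %| n)%N ->
    forall (V : finType) (H : kgraph k V), #|V| = n ->
    (forall A : {set V}, balanced A ->
       ~ eps_close eps H (odd_kgraph k A) /\
       ~ eps_close eps H (even_kgraph k A)) ->
    (1 / 2 - gamma) * 'C(n - d, k - d)%:R <= (min_degree d H)%:R ->
    contains_hamilton_cycle k./2 H.
Proof.
(* [4 <= k] gives blocks of at least two entries, so that a head can be exchanged while a tail
   remains. *)
have [L mL] : exists L, k./2 = L.+2 by exists k./2.-2; lia.
have km : k = (L.+2 + L.+2)%N by rewrite -mL addnn even_halfK.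
have hd' : (L.+2 <= d <= k)%N by rewrite -mL; move: hd; lia.
have [gamma [n1 [gamma0 main]]] := hamilton_cycle_nonextremal km hd' heps.
exists gamma, n1; split=> // n n_big dvd V H cV not_close hdeg.
by rewrite mL in dvd *; apply: main; rewrite ?cV.
Qed.
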